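(* Let $(\mathbb N,E)$ be a self-similar graph satisfying the assumption that for every $e\in E^1$ there is $m\in\mathbb N$ with $m|_e\neq 0$. Let $(\mathcal V,\mathcal S)$ be a Toeplitz representation of $(\mathbb N,E)$ on a Hilbert space $\mathcal H$, and write $V=V_1$. With the subspaces defined in the context, $\mathcal H$ decomposes into a direct sum of reducing subspaces for $(\mathcal V,\mathcal S)$ as follows: $$\mathcal H=\mathcal H_C^U\oplus\mathcal H_C^S\oplus\Big(\bigoplus_{\Omega_v\in E^0/\sim}\mathcal H_{[v]}^U\Big)\oplus\Big(\bigoplus_{v\in E^0}\mathcal H_v^S\Big).$$ When $(\mathcal V,\mathcal S)$ is restricted to these reducing subspaces, one has the following components. (i) (Unitary + CK) On $\mathcal H_C^U$, $\mathcal V$ is a unitary and $\mathcal S$ is a Cuntz-Krieger $E$-family. (ii) (Pure + CK) On $\mathcal H_C^S$, $\mathcal V$ is pure and $\mathcal S$ is a Cuntz-Krieger $E$-family. (iii) (Unitary + pure shift) For each equivalence class $\Omega_v$, on $\mathcal H_{[v]}^U$, $\mathcal V$ is unitary and $\mathcal S$ is a direct sum of some amplifications of $\bigoplus_{u\in\Omega_v}L_{E,u}$. (iv) (Left regular) For each vertex $v\in E^0$, on $\mathcal H_v^S$, $(\mathcal V,\mathcal S)$ is unitarily equivalent to an amplification $(\lambda_v^{\mathbb N},\lambda_v^E)^{(\alpha_v)}$ of the left regular representation, where $\alpha_v$ is the dimension of the space $\mathcal W_{\mathbb N,v}=\ker V^*\cap\mathcal W_v^S$ and $\mathcal W_v^S=\big(S_v-\sum_{e\in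 vE^1}S_eS_e^*\big)\mathcal H_v^S$. Here, each unit vector in $\mathcal W_{\mathbb N,v}$ is a wandering vector for $(\mathcal V,\mathcal S)$.
   Context: Graphs. $E=(E^0,E^1,r,s)$ is a finite directed graph (vertices $E^0$, edges $E^1$, range and source maps $r,s$), source-free: $vE^1:=\{e\in E^1: r(e)=v\}\neq\emptyset$ for every $v\in E^0$. $E^d$ is the set of paths of length $d$ (vertices are paths of length $0$); $\mu\nu$ is a path when $s(\mu)=r(\nu)$; $E^*=\bigcup_{d\ge0}E^d$. $\mathbb N=\{0,1,2,\dots\}$. $\operatorname{Aut}(E)$ is the group of bijections of $E^0\cup E^1$ preserving $E^0$ and $E^1$ and commuting with $r$ and $s$. Self-similar graph $(\mathbb N,E)$: a semigroup homomorphism $\mathbb N\to\operatorname{Aut}(E)$, written $p\cdot\mu$, together with a restriction map $\mathbb N\times(E^0\cup E^1)\to\mathbb N$, $(p,\mu)\mapsto p|_\mu$, such that $(p+q)|_\mu=p|_{q\cdot\mu}+q|_\mu$; $p|_v=p$ for $v\in E^0$; $0|_e=0$ for $e\in E^1$; and $p|_e\cdot v=p\cdot v$ whenever $s(e)=v$. Action and restriction extend to $E^*$ by $p\cdot(\mu\nu)=(p\cdot\mu)(p|_\mu\cdot\nu)$ and $p|_{\mu\nu}=(p|_\mu)|_\nu$. The orbit of $v\in E^0$ is $\Omega_v=\{p\cdot v:p\in\mathbb N\}$; orbits are the classes of an equivalence relation $\sim$ on $E^0$. TCK families. A Toeplitz-Cuntz-Krieger (TCK) $E$-family $\mathcal S=\{S_\mu:\mu\in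 E^0\cup E^1\}$ consists of pairwise orthogonal projections $S_v$ ($v\in E^0$) and operators $S_e$ ($e\in E^1$) with $S_e^*S_e=S_{s(e)}$ and $\sum_{e\in vE^1}S_eS_e^*\le S_v$ for all $v$. It is Cuntz-Krieger (CK) if $\sum_{e\in vE^1}S_eS_e^*=S_v$ for all $v$. For $\mu=e_1\cdots e_k$, $S_\mu=S_{e_1}\cdots S_{e_k}$. $L_{E,v}$: on the closed span of $\{\delta_\nu:\nu\in E^*,s(\nu)=v\}\subseteq\ell^2(E^* )$, the TCK family $L_\mu\delta_\nu=\delta_{\mu\nu}$ if $s(\mu)=r(\nu)$, and $0$ otherwise. Toeplitz representation of $(\mathbb N,E)$ on $\mathcal H$: a pair $(\mathcal V,\mathcal S)$ with $\mathcal V=\{V_p\}_{p\in\mathbb N}$ isometries, $V_pV_q=V_{p+q}$, $V_0=I$ (so $V_p=V^p$, $V=V_1$), and $\mathcal S$ a TCK $E$-family, such that $V_pS_\mu=S_{p\cdot\mu}V_{p|_\mu}$ and $V_p^*S_{p\cdot\mu}=S_\mu V_{p|_\mu}^*$ for all $p\in\mathbb N$, $\mu\in E^0\cup E^1$. $\mathcal V$ is called unitary (pure) if $V$ is a unitary (a pure isometry, i.e. a multiple of the unilateral shift). Left regular representations: on $\ell^2(E^*\times\mathbb N)$ with basis $\delta_{\mu,p}$, let $V_q\delta_{\mu,p}=\delta_{q\cdot\mu,\,q|_\mu+p}$ and $S_\nu\delta_{\mu,p}=\delta_{\nu\mu,p}$ if $s(\nu)=r(\mu)$, $0$ otherwise.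 For $v\in E^0$, $(\lambda_v^{\mathbb N},\lambda_v^E)$ is its restriction to the reducing subspace $\overline{\operatorname{span}}\{\delta_{\mu,p}: s(\mu)=p\cdot v\}$. The exponent $(\alpha)$ denotes the direct sum of $\alpha$ copies. Wandering vector for $(\mathcal V,\mathcal S)$: a unit vector $\xi$ such that the vectors $S_\mu V_p\xi$ ($\mu\in E^*$, $p\in\mathbb N$) are pairwise orthogonal and each is either $0$ or a unit vector. Subspaces. $\mathcal W_v=(S_v-\sum_{e\in vE^1}S_eS_e^* )\mathcal H$; $\mathcal H_v=\bigoplus_{\mu\in E^*}S_\mu\mathcal W_v$; $\mathcal H_{[v]}=\bigoplus_{u\in\Omega_v}\mathcal H_u$; $\mathcal H_C=\bigcap_{d\ge1}\bigoplus_{\mu\in E^d}S_\mu\mathcal H$; $\mathcal H^U=\bigcap_{n\in\mathbb N}V^n\mathcal H$; $\mathcal H^S=\bigoplus_{n\in\mathbb N}V^n(\ker V^* )$; $\mathcal H_C^U=\mathcal H^U\cap\mathcal H_C$; $\mathcal H_C^S=\mathcal H^S\cap\mathcal H_C$; $\mathcal H_{[v]}^U=\mathcal H^U\cap\mathcal H_{[v]}$; and $\mathcal H_v^S=\mathcal H^S\cap\mathcal H_v$.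
   Formalization: H is exhausted only if the S_v sum to I (otherwise the range of their sum is decomposed); as H_v^S need not be reducing, reducibility and (iv) are stated for the closed span of all S_mu V_p W_{N,v}, proved equal to H_v^S whenever H_v^S is reducing. *)

(* Defs.v *)
From HB Require Import structures.
From mathcomp Require Import all_boot all_order all_algebra.
From mathcomp Require Import all_classical all_reals all_analysis.
From mathcomp Require Import sesquilinear complex.

Set Implicit Arguments.
Unset Strict Implicit.
Unset Printing Implicit Defensive.

Import Order.TTheory GRing.Theory Num.Theory numFieldNormedType.Exports.

Local Open Scope classical_set_scope.
Local Open Scope ring_scope.

Record hilbert (R : realType) := Hilbert {
  hsort :> completeNormedModType R[i];
  hdot : {dot hsort for Num.conj};
  hdotE : forall x : hsort, hdot x x = `|x| ^+ 2 }.

Section subspaces.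
Variables (R : realType) (H : hilbert R).
Implicit Types (X Y : set H) (T : H -> H).

Definition is_subspace X :=
  X 0 /\ forall (a : R[i]) x y, X x -> X y -> X (a *: x + y).

Definition closed_subspace X := is_subspace X /\ closed X.

Definition cspan (A : set H) : set H := smallest closed_subspace A.

Definition orthogonal_sets X Y := forall x y, X x -> Y y -> hdot H x y = 0.

(* Hilbert-space direct sum of mutually orthogonal closed subspaces. *)
Definition orth_sum (I : Type) (D : set I) (X : I -> set H) Y :=
  [/\ forall i, D i -> closed_subspace (X i),
      forall i j, D i -> D j -> i <> j -> orthogonal_sets (X i) (X j)
    & cspan (\bigcup_(i in D) X i) = Y].

Definition bounded_on X T :=
  exists M : R[i], forall x, X x -> `|T x| <= M * `|x|.

(* The adjoint of the restriction of T to X, computed inside X; the value is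
   unique when it exists, and it exists (Riesz) when X is a closed subspace,
   T maps X into X and T is linear and bounded on X. *)
Definition adj_on X T (y : H) : H :=
  xget 0 [set z | X z /\ forall x, X x -> hdot H (T x) y = hdot H x z].

Definition adj T := adj_on setT T.

Definition hilbert_dim X (A : choiceType) :=
  exists b : A -> H,
    [/\ forall a, X (b a),
        forall a a', hdot H (b a) (b a') = (a == a')%:R
      & cspan (range b) = X].

End subspaces.

Section ell2.
Variables (R : realType) (I : choiceType).

Definition sqr_norm2 (f : I -> R[i]) : \bar R :=
  \esum_(i in [set: I]) ((complex.Re `|f i|) ^+ 2)%:E.

(* The closed span of the basis vectors delta_i, i in J, inside l^2(I). *)
Definition ell2 (J : set I) : set (I -> R[i]) :=
  [set f | (forall i, ~ J i -> f i = 0) /\ (sqr_norm2 f < +oo)%E].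

Definition delta (i : I) : I -> R[i] := fun j => (i == j)%:R.

(* The operator delta_i |-> delta_(sigma i), and delta_i |-> 0 when
   sigma i = None.  It is used for sigma injective on its domain, so that the
   sum has at most one term. *)
Definition push (sigma : I -> option I) (f : I -> R[i]) : I -> R[i] :=
  fun j => \sum_(i \in [set i | sigma i = Some j]) f i.

Lemma push_delta sigma i :
  push sigma (delta i) = if sigma i is Some j then delta j else (fun=> 0).
Proof.
apply/funext => j; rewrite /push.
have := @fsbig_widen _ _ 0 (@GRing.add R[i])
  ([set i] `&` [set k | sigma k = Some j]) [set k | sigma k = Some j] (delta i).
move=> <-; last 2 first.
- exact: subIsetr.
- move=> k [/= kj nk]; rewrite /delta; case: eqVneq => // ik.
  by case: nk; split.
have [sij|nij] := pselect (sigma i = Some j).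
  rewrite [X in \sum_(k \in X) _](_ : _ = [set i]); last first.
    by apply/seteqP; split => [k []//|k /= ->].
  by rewrite fsbig_set1 sij /delta !eqxx.
rewrite [X in \sum_(k \in X) _](_ : _ = set0); last first.
  by apply/seteqP; split => [k [/= -> ]//|].
rewrite fsbig_set0; case E : (sigma i) => [k|//].
by rewrite /delta; case: eqVneq => // kj; case: nij; rewrite E kj.
Qed.

End ell2.

Section unitary_equivalence.
Variables (R : realType) (H : hilbert R) (I : choiceType).

(* U restricts to a unitary from X onto the closed span of the delta_i, i in J;
   its values off X are irrelevant. *)
Definition unitary_onto_ell2 (X : set H) (J : set I)
    (U : {linear H -> (I -> R[i])}) :=
  (forall x, X x -> sqr_norm2 (U x) = ((complex.Re `|x|) ^+ 2)%:E) /\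
  U @` X = @ell2 R I J.

Definition intertwines (X : set H) (U : {linear H -> (I -> R[i])})
    (T : H -> H) (T' : (I -> R[i]) -> (I -> R[i])) :=
  forall x, X x -> U (T x) = T' (U x).

End unitary_equivalence.

(* The direct sum of copies of T indexed by A, on l^2(I x A). *)
Definition ampl (C I A : Type) (T : (I -> C) -> (I -> C))
    (f : I * A -> C) : I * A -> C :=
  fun ia => T (fun i => f (i, ia.2)) ia.1.

Definition ampl_dom (I A : Type) (J : set I) : set (I * A) := [set ia | J ia.1].

Definition shift_map (n : nat) : option nat := Some n.+1.

Section single_operator.
Variables (R : realType) (H : hilbert R).

Definition unitary_on (X : set H) (V : H -> H) :=
  (forall x, X x -> `|V x| = `|x|) /\ V @` X = X.

(* The restriction of V to X is a multiple of the unilateral shift. *)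
Definition pure_on (X : set H) (V : H -> H) :=
  exists (A : choiceType) (U : {linear H -> (nat * A -> R[i])}),
    [/\ V @` X `<=` X, unitary_onto_ell2 X setT U
      & intertwines X U V (@ampl _ nat A (@push R nat shift_map))].

End single_operator.

Record graph := Graph {
  vert : finType;
  edge : finType;
  rg : edge -> vert;
  sr : edge -> vert;
  source_free : forall v, exists e, rg e = v }.

Definition gen (E : graph) := (vert E + edge E)%type.

(* E^* : the pair (w, [:: e1; ...; ek]) is the path e1...ek with range w; it is
   the vertex w when k = 0. *)
Fixpoint walk (E : graph) (w : vert E) (l : seq (edge E)) : bool :=
  if l is e :: l' then (rg e == w) && walk (sr e) l' else true.

Record gpath (E : graph) := GPath {
  gval : vert E * seq (edge E);
  gvalP : walk gval.1 gval.2 }.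

HB.instance Definition _ (E : graph) := [isSub for @gval E].
HB.instance Definition _ (E : graph) := [Choice of gpath E by <:].

Section paths.
Variable E : graph.
Implicit Types mu : gpath E.

Definition prange mu : vert E := (gval mu).1.
Definition pedges mu : seq (edge E) := (gval mu).2.
Definition plen mu : nat := size (pedges mu).
Definition psource mu : vert E := last (prange mu) (map (@sr E) (pedges mu)).

(* The path g mu, defined when s(g) = r(mu). *)
Definition gcat (g : gen E) mu : option (gpath E) :=
  match g with
  | inl v => if v == prange mu then Some mu else None
  | inr e => if sr e == prange mu then insub (rg e, e :: pedges mu) else None
  end.

Lemma gcat_edge e mu : sr e = prange mu ->
  omap (@gval E) (gcat (inr e) mu) = Some (rg e, e :: pedges mu).
Proof.
move=> sre; rewrite /gcat sre eqxx; case: insubP => [u _ /= <- //|].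
by rewrite /= eqxx sre => /negP[]; exact: gvalP.
Qed.

End paths.

Record self_similar (E : graph) := SelfSimilar {
  actv : nat -> vert E -> vert E;
  acte : nat -> edge E -> edge E;
  act := fun p (g : gen E) =>
    match g with inl v => inl (actv p v) | inr e => inr (acte p e) end : gen E;
  res : nat -> gen E -> nat;
  actv_bij : forall p, bijective (actv p);
  acte_bij : forall p, bijective (acte p);
  act_rg : forall p e, rg (acte p e) = actv p (rg e);
  act_sr : forall p e, sr (acte p e) = actv p (sr e);
  actD : forall p q g, act (p + q)%N g = act p (act q g);
  resD : forall p q g, res (p + q)%N g = (res p (act q g) + res q g)%N;
  res_vert : forall p v, res p (inl v) = p;
  res0_edge : forall e, res 0 (inr e) = 0%N;
  res_act_sr : forall p e, actv (res p (inr e)) (sr e) = actv p (sr e) }.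

Section path_action.
Variables (E : graph) (N : self_similar E).

Fixpoint act_edges (p : nat) (l : seq (edge E)) : seq (edge E) :=
  if l is e :: l' then acte N p e :: act_edges (res N p (inr e)) l' else [::].

Fixpoint res_edges (p : nat) (l : seq (edge E)) : nat :=
  if l is e :: l' then res_edges (res N p (inr e)) l' else p.

Lemma walk_act p w l : walk w l -> walk (actv N p w) (act_edges p l).
Proof.
elim: l p w => //= e l IH p w /andP[/eqP <- wl]; rewrite act_rg eqxx /=.
by rewrite act_sr -res_act_sr; exact: IH.
Qed.

Definition act_path (p : nat) (mu : gpath E) : gpath E :=
  @GPath E (actv N p (gval mu).1, act_edges p (gval mu).2)
    (walk_act p (gvalP mu)).

Definition res_path (p : nat) (mu : gpath E) : nat := res_edges p (pedges mu).

Definition vorbit (v : vert E) : set (vert E) := range (fun p => actv N p v).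

Definition orbits : set (set (vert E)) := range vorbit.

End path_action.

Section model_representations.
Variables (R : realType) (E : graph) (N : self_similar E).

(* The left regular family on l^2 of E^*; L_{E,v} is its restriction to the
   closed span of the delta_nu with nu in LE_dom v. *)
Definition LE (g : gen E) := @push R (gpath E) (gcat g).

Definition LE_dom (v : vert E) : set (gpath E) := [set nu | psource nu = v].

(* The left regular representation on l^2 of E^* x N. *)
Definition lamN (q : nat) := @push R (gpath E * nat)%type
  (fun mp => Some (act_path N q mp.1, (res_path N q mp.1 + mp.2)%N)).

Definition lamE (g : gen E) := @push R (gpath E * nat)%type
  (fun mp => omap (fun nu => (nu, mp.2)) (gcat g mp.1)).

Definition lam_dom (v : vert E) : set (gpath E * nat) :=
  [set mp | psource mp.1 = actv N mp.2 v].

End model_representations.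

Section representations.
Variables (R : realType) (H : hilbert R) (E : graph).
Variables (V : nat -> {linear H -> H}) (S : gen E -> {linear H -> H}).

Definition TCK_on (X : set H) :=
  [/\ forall g, S g @` X `<=` X /\ bounded_on X (S g),
      forall v x, X x ->
        S (inl v) (S (inl v) x) = S (inl v) x /\
        adj_on X (S (inl v)) x = S (inl v) x,
      forall v w x, v <> w -> X x -> S (inl v) (S (inl w) x) = 0,
      forall e x, X x -> adj_on X (S (inr e)) (S (inr e) x) = S (inl (sr e)) x
    & forall v x, X x ->
        hdot H (\sum_(e : edge E | rg e == v)
                  S (inr e) (adj_on X (S (inr e)) x)) x
        <= hdot H (S (inl v) x) x].

Definition CK_on (X : set H) :=
  TCK_on X /\
  forall v x, X x ->
    \sum_(e : edge E | rg e == v) S (inr e) (adj_on X (S (inr e)) x)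
    = S (inl v) x.

(* A TCK family need not satisfy \sum_v S_v = 1 (it may even be zero); the
   components of the decomposition all lie in the range of \sum_v S_v. *)
Definition nondegenerate_family := forall x, \sum_(v : vert E) S (inl v) x = x.

Definition essential : set H := range (fun x => \sum_(v : vert E) S (inl v) x).

Record toeplitz (N : self_similar E) : Prop := Toeplitz {
  toeplitz_isometry : forall p x, `|V p x| = `|x|;
  toeplitz_V0 : forall x, V 0%N x = x;
  toeplitz_VD : forall p q x, V p (V q x) = V (p + q)%N x;
  toeplitz_TCK : TCK_on setT;
  toeplitz_VS : forall p g x,
    V p (S g x) = S (act N p g) (V (res N p g) x);
  toeplitz_adjVS : forall p g x,
    adj (V p) (S (act N p g) x) = S g (adj (V (res N p g)) x) }.

Definition reducing (X : set H) :=
  [/\ closed_subspace X,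
      forall p, V p @` X `<=` X /\ adj (V p) @` X `<=` X
    & forall g, S g @` X `<=` X /\ adj (S g) @` X `<=` X].

Definition Spath (mu : gpath E) (x : H) : H :=
  if pedges mu is [::] then S (inl (prange mu)) x
  else foldr (fun e y => S (inr e) y) x (pedges mu).

Definition wandering_vector (xi : H) :=
  [/\ `|xi| = 1,
      forall mu p nu q, (mu, p) <> (nu, q) ->
        hdot H (Spath mu (V p xi)) (Spath nu (V q xi)) = 0
    & forall mu p, Spath mu (V p xi) = 0 \/ `|Spath mu (V p xi)| = 1].

Definition defect (v : vert E) (x : H) : H :=
  S (inl v) x
  - \sum_(e : edge E | rg e == v) S (inr e) (adj (S (inr e)) x).

Definition ker_adjV : set H := [set x | adj (V 1%N) x = 0].

Definition W_ (v : vert E) : set H := range (defect v).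

Definition H_ (v : vert E) : set H :=
  cspan (\bigcup_(mu in [set: gpath E]) Spath mu @` W_ v).

Definition H_orb (Om : set (vert E)) : set H := cspan (\bigcup_(u in Om) H_ u).

Definition H_C : set H :=
  \bigcap_(d in [set d | (1 <= d)%N])
    cspan (\bigcup_(mu in [set mu | plen mu = d]) range (Spath mu)).

Definition H_U : set H := \bigcap_(n in [set: nat]) range (V n).

Definition H_S : set H := cspan (\bigcup_(n in [set: nat]) V n @` ker_adjV).

Definition H_CU : set H := H_U `&` H_C.

Definition H_CS : set H := H_S `&` H_C.

Definition HU_orb (Om : set (vert E)) : set H := H_U `&` H_orb Om.

Definition HS_ (v : vert E) : set H := H_S `&` H_ v.

Definition WS_ (v : vert E) : set H := defect v @` HS_ v.

Definition WN_ (v : vert E) : set H := ker_adjV `&` WS_ v.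

(* The reducing subspace generated by WN_ v.  V 1 maps H_ v into H_ (1 . v), so
   HS_ v itself is invariant under V only when v is fixed by the action or
   HS_ v = 0; in those cases the two spaces agree, and in general they have the
   same sum over each orbit. *)
Definition HSred_ (v : vert E) : set H :=
  cspan (\bigcup_(mu in [set: gpath E]) \bigcup_(p in [set: nat])
           (fun x => Spath mu (V p x)) @` WN_ v).

End representations.

Inductive wold_index (E : graph) :=
  | UnitaryCK
  | PureCK
  | UnitaryShift of set (vert E)
  | PureShift of vert E.

Arguments UnitaryCK {E}.
Arguments PureCK {E}.

Section wold.
Variables (R : realType) (H : hilbert R) (E : graph) (N : self_similar E).
Variables (V : nat -> {linear H -> H}) (S : gen E -> {linear H -> H}).

Definition wold_dom : set (wold_index E) :=
  [set i | if i is UnitaryShift Om then orbits N Om else True].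

(* F v is the component attached to the vertex v. *)
Definition wold_piece (F : vert E -> set H) (i : wold_index E) : set H :=
  match i with
  | UnitaryCK => H_CU V S
  | PureCK => H_CS V S
  | UnitaryShift Om => HU_orb V S Om
  | PureShift v => F v
  end.

End wold.

(* Main.v *)
(* Two Wold decompositions are carried out simultaneously.  For the isometry
   V, H is the sum of H_U, the intersection of the ranges of the V^n, and of
   H_S = H_U^perp.  For the Toeplitz-Cuntz-Krieger family S, the range of
   sum_v S_v is the sum of H_C and of the spaces H_v generated by the wandering
   spaces W_v = D_v H, D_v = S_v - sum_(e in v E^1) S_e S_e^*.

   The relations between V and S give D_(p.v) V_p = V_p D_v, so that V_p V_p^*
   leaves H_C and every H_v invariant, which makes the two decompositions
   compatible, while V_p itself only preserves the sum of the H_v over an orbit.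
   The space H_U reduces S because
   V_n V_n^* S_(n.e) = S_(n.e) V_(n|_e) V_(n|_e)^*; for invariance under S_e^*
   one needs n with n.e = e and n|_e arbitrarily large, and this is where the
   hypothesis on restrictions is used.

   A space spanned by vectors S_mu V_p w is identified by showing that a vector
   x orthogonal to all of them vanishes, by inspecting D_v S_mu^* x.  The unitary
   equivalences then come from explicit orthonormal bases: S_mu V_p b with b in
   a basis of the intersection of ker V^* and W_v for the left regular part, and
   S_nu V_(p_u) b, where p_u moves v to u = s(nu) and b is in a basis of the
   intersection of W_v and H_U, for the unitary part. *)
Require Import Defs.
From HB Require Import structures.
From mathcomp Require Import all_boot all_order all_algebra.
From mathcomp Require Import all_classical all_reals all_analysis.
From mathcomp Require Import sesquilinear complex.
From mathcomp Require Import ring lra.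
Set Implicit Arguments.
Unset Strict Implicit.
Unset Printing Implicit Defensive.
Import Order.TTheory GRing.Theory Num.Theory numFieldNormedType.Exports.
Local Open Scope classical_set_scope.
Local Open Scope ring_scope.

(** * Hilbert space geometry *)

Section dot_product.
Variables (R : realType) (H : hilbert R).
Implicit Types (x y z : H) (a : R[i]).
Local Notation "''[' x , y ]" := (hdot H x y) : ring_scope.

Lemma dotDl x y z : '[x + y, z] = '[x, z] + '[y, z].
Proof. exact: linearDl. Qed.

Lemma dotDr x y z : '[z, x + y] = '[z, x] + '[z, y].
Proof. exact: linearDr. Qed.

Lemma dotNl x z : '[- x, z] = - '[x, z].
Proof. exact: linearNl. Qed.

Lemma dotNr x z : '[z, - x] = - '[z, x].
Proof. exact: linearNr. Qed.

Lemma dotBl x y z : '[x - y, z] = '[x, z] - '[y, z].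
Proof. by rewrite dotDl dotNl. Qed.

Lemma dotBr x y z : '[z, x - y] = '[z, x] - '[z, y].
Proof. by rewrite dotDr dotNr. Qed.

Lemma dot0l z : '[0, z] = 0.
Proof. exact: linear0l. Qed.

Lemma dot0r z : '[z, 0] = 0.
Proof. exact: linear0r. Qed.

Lemma dotZl a x z : '[a *: x, z] = a * '[x, z].
Proof. exact: linearZl_LR. Qed.

Lemma dotZr a x z : '[z, a *: x] = a^* * '[z, x].
Proof. exact: linearZr_LR. Qed.

Lemma dotC x y : '[x, y] = '[y, x]^*.
Proof. by have := @hermC _ _ _ _ (hdot H) x y; rewrite expr0 mul1r. Qed.

Lemma dot_eq0C x y : '[x, y] = 0 -> '[y, x] = 0.
Proof. by move=> xy; rewrite dotC xy rmorph0. Qed.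

Lemma dot_suml (I : Type) (r : seq I) (P : pred I) (F : I -> H) z :
  '[\sum_(i <- r | P i) F i, z] = \sum_(i <- r | P i) '[F i, z].
Proof.
by elim/big_rec2: _ => [|i u v _ <-]; rewrite ?dot0l ?dotDl.
Qed.

Lemma dot_sumr (I : Type) (r : seq I) (P : pred I) (F : I -> H) z :
  '[z, \sum_(i <- r | P i) F i] = \sum_(i <- r | P i) '[z, F i].
Proof.
by elim/big_rec2: _ => [|i u v _ <-]; rewrite ?dot0r ?dotDr.
Qed.

(** Norms take values in [R[i]]; square norms are kept in [R], where order and linear arithmetic
    apply. *)
Definition nsq x : R := complex.Re '[x, x].

Lemma dotE x : '[x, x] = (nsq x)%:C%C.
Proof.
by rewrite /nsq RRe_real // hdotE realE exprn_ge0.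
Qed.

Lemma nsq_norm x : `|x| ^+ 2 = (nsq x)%:C%C.
Proof. by rewrite -dotE hdotE. Qed.

Lemma nsqE x : nsq x = (complex.Re `|x|) ^+ 2.
Proof.
by apply: complexI; rewrite -nsq_norm rmorphXn /= RRe_real.
Qed.

Lemma nsq_ge0 x : 0 <= nsq x.
Proof. by rewrite -ler0c -dotE hdotE exprn_ge0. Qed.

Lemma nsq_eq0 x : nsq x = 0 -> x = 0.
Proof.
by move=> n0; apply/eqP; rewrite -normr_eq0 -sqrf_eq0 nsq_norm n0.
Qed.

Lemma dot_eq0 x : '[x, x] = 0 -> x = 0.
Proof. by rewrite dotE => -[] /nsq_eq0. Qed.

Lemma nsq0 : nsq 0 = 0.
Proof. by rewrite /nsq dot0l. Qed.

Lemma dot_inj x y : (forall z, '[z, x] = '[z, y]) -> x = y.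
Proof.
move=> xy; apply/eqP; rewrite -subr_eq0; apply/eqP/dot_eq0.
by rewrite dotBr xy subrr.
Qed.

Lemma nsqN x : nsq (- x) = nsq x.
Proof. by rewrite /nsq dotNl dotNr opprK. Qed.

Lemma nsqBC x y : nsq (x - y) = nsq (y - x).
Proof. by rewrite -nsqN opprB. Qed.

Lemma nsqZ a x : ((nsq (a *: x))%:C)%C = `|a| ^+ 2 * (nsq x)%:C%C.
Proof. by rewrite -!dotE dotZl dotZr mulrA normCK. Qed.

Lemma parallelogram x y : nsq (x + y) + nsq (x - y) = 2 * (nsq x + nsq y).
Proof.
rewrite mulr_natl; apply: complexI; rewrite rmorphMn !rmorphD /= -!dotE.
by rewrite !(dotDl, dotDr, dotNl, dotNr); ring.
Qed.

Lemma nsqD_le x y : nsq (x + y) <= 2 * (nsq x + nsq y).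
Proof. by rewrite -parallelogram lerDl nsq_ge0. Qed.

Lemma pythagoras x y : '[x, y] = 0 -> nsq (x + y) = nsq x + nsq y.
Proof.
move=> xy; apply: complexI; rewrite rmorphD /= -!dotE dotDl !dotDr.
by rewrite xy (dot_eq0C xy) addr0 add0r.
Qed.

(** Multiplying through by the square norm of [y] keeps the identity valid for [y = 0]. It yields
    both Cauchy-Schwarz and the orthogonality step of the projection theorem. *)
Lemma nsq_proj x y :
  (nsq y)%:C%C * (nsq (x - ('[x, y] / '[y, y]) *: y))%:C%C
    = (nsq x)%:C%C * (nsq y)%:C%C - `|'[x, y]| ^+ 2.
Proof.
have [y0|y0] := eqVneq '[y, y] 0.
  by rewrite (dot_eq0 y0) nsq0 dot0r mulr0 mul0r normr0 expr0n subrr.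
set t := _ / _; have o : '[x - t *: y, t *: y] = 0.
  by rewrite dotZr dotBl dotZl /t divfK // subrr mulr0.
have := pythagoras o; rewrite subrK => /(congr1 (fun r => r%:C%C)).
rewrite rmorphD /= nsqZ => ->.
have -> : `|'[x, y]| ^+ 2 = `|t| ^+ 2 * (nsq y)%:C%C * (nsq y)%:C%C.
  rewrite -mulrA -expr2 -exprMn -dotE; congr (_ ^+ 2).
  by rewrite -[X in _ * X]ger0_norm ?hdotE ?exprn_ge0 // -hdotE -normrM divfK.
by ring.
Qed.

Lemma cauchy_schwarz x y : `|'[x, y]| ^+ 2 <= ((nsq x * nsq y)%:C)%C.
Proof.
rewrite rmorphM /= -subr_ge0 -nsq_proj -rmorphM ler0c.
by rewrite mulr_ge0 ?nsq_ge0.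
Qed.

End dot_product.

(** * Closedness and completeness through square norms; orthogonal complements *)

Section closed_subspaces.
Variables (R : realType) (H : hilbert R).
Implicit Types (x y z : H) (a : R[i]) (X Y A : set H).
Local Notation "''[' x , y ]" := (hdot H x y) : ring_scope.

Lemma norm_lt_nsq x (e : R) : 0 < e -> (`|x| < e%:C%C) = (nsq x < e ^+ 2).
Proof.
move=> e0; rewrite -ltcR -nsq_norm rmorphXn /=.
by rewrite ltr_pXn2r // nnegrE ?ler0c ?normr_ge0 ?ltW.
Qed.

(** The order of [R[i]] compares only numbers with equal imaginary parts, so a positive element is
    real. *)
Lemma gt0C (e : R[i]) : 0 < e -> exists2 r : R, 0 < r & e = r%:C%C.
Proof.
case: e => r i; rewrite ltcE /= => /andP[/eqP -> r0].
by exists r.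
Qed.

Lemma closedPnsq X : closed X <->
  (forall x, (forall e : R, 0 < e -> exists2 y, X y & nsq (x - y) < e) -> X x).
Proof.
split=> cX x.
  move=> xX; apply: cX => B /nbhs_ballP[e /= /gt0C[r r0 ->]] rB.
  have [y Xy xy] := xX (r ^+ 2) (exprn_gt0 2 r0).
  by exists y; split=> //; apply: rB; rewrite -ball_normE /= norm_lt_nsq.
move=> xX; apply: cX => e e0.
have s0 : 0 < ((Num.sqrt e)%:C)%C by rewrite ltcR sqrtr_gt0.
have [y [Xy]] := xX _ (nbhsx_ballx x _ s0).
by rewrite -ball_normE /= norm_lt_nsq ?sqrtr_gt0 // sqr_sqrtr ?ltW //; exists y.
Qed.

Lemma nsq_cauchy (u : nat -> H) :
  (forall e : R, 0 < e -> exists n0, forall m n,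
     (n0 <= m)%N -> (n0 <= n)%N -> nsq (u m - u n) < e) ->
  exists l, forall e : R, 0 < e -> exists n0, forall n,
     (n0 <= n)%N -> nsq (u n - l) < e.
Proof.
move=> cu.
have : cauchy (u @ \oo).
  apply/cauchyP => e /gt0C[r r0 ->].
  have [n0 un0] := cu _ (exprn_gt0 2 r0); exists (u n0).
  exists n0 => // n /= n0n; rewrite -ball_normE /= norm_lt_nsq //.
  exact: un0.
move=> /cauchy_cvg cvu; exists (lim (u @ \oo)) => e e0.
have s0 : 0 < ((Num.sqrt e)%:C)%C by rewrite ltcR sqrtr_gt0.
have [n0 _ un0] := cvu _ (nbhsx_ballx _ _ s0).
exists n0 => n n0n; have := un0 _ n0n.
by rewrite -ball_normE /= norm_lt_nsq ?sqrtr_gt0 // sqr_sqrtr ?ltW // nsqBC.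
Qed.

Lemma inv_small (F : archiRealFieldType) (e : F) : 0 < e ->
  exists n0, forall n, (n0 <= n)%N -> n.+1%:R^-1 < e.
Proof.
move=> e0; have [n0 hn0] : exists n0, e^-1 < n0%:R.
  by exists (Num.bound e^-1); rewrite archi_boundP // invr_ge0 ltW.
exists n0 => n n0n; rewrite invf_plt ?posrE //; apply: lt_le_trans hn0 _.
by rewrite ler_nat leqW.
Qed.

(** This bound arises twice: for minimising sequences in the projection theorem and for finite sums
    in Riesz-Fischer. *)
Lemma nsq_cauchy_inv (u : nat -> H) :
  (forall m n, nsq (u m - u n) <= 2 * (m.+1%:R^-1 + n.+1%:R^-1)) ->
  exists l, forall e : R, 0 < e -> exists n0, forall n,
     (n0 <= n)%N -> nsq (u n - l) < e.
Proof.
move=> uB; apply: nsq_cauchy => e e0.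
have [n0 hn0] := inv_small (divr_gt0 e0 (ltr0n R 4)).
exists n0 => m n /hn0 hm /hn0 hn; apply: le_lt_trans (uB m n) _.
by move: hm hn; move: (m.+1%:R^-1) (n.+1%:R^-1) => p q; lra.
Qed.

Definition oc A : set H := [set x | forall y, A y -> '[x, y] = 0].

Lemma small_eq0 (K : R) (a : R[i]) :
  (forall e : R, 0 < e -> `|a| ^+ 2 <= (e * K)%:C%C) -> a = 0.
Proof.
move=> aK; apply/eqP; rewrite -normr_eq0 -sqrf_eq0.
have [r] : exists r : R, `|a| ^+ 2 = r%:C%C.
  by exists (complex.Re (`|a| ^+ 2)); rewrite RRe_real // realE exprn_ge0.
move=> ar; move: aK; rewrite ar => aK.
have r0 : 0 <= r by rewrite -ler0c -ar exprn_ge0.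
have K0 : 0 <= K.
  have := aK 1 ltr01; rewrite lecR mul1r; exact: le_trans.
apply/eqP; congr (_%:C%C); apply/eqP; rewrite eq_le r0 andbT leNgt.
apply/negP => rp; have K1 : 0 < K + 1 by lra.
(* With this [e] the bound [e * K] is at most [r / 2]; dividing by [K + 1] stays legitimate when
   [K = 0]. *)
have := aK (r / 2 / (K + 1)); rewrite lecR => /(_ _)/wrap[].
  by rewrite !divr_gt0.
move=> h; have : r / 2 / (K + 1) * K <= r / 2.
  rewrite mulrAC ler_pdivrMr // ler_wpM2l //; lra.
lra.
Qed.

Lemma oc_closed A : closed_subspace (oc A).
Proof.
split; first split; first by move=> y _; rewrite dot0l.
  by move=> a x y ox oy z Az; rewrite dotDl dotZl ox // oy // mulr0 addr0.
apply/closedPnsq => x xA y Ay.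
apply: (@small_eq0 (nsq y)) => e /xA[z oz xz].
have -> : '[x, y] = '[x - z, y] by rewrite dotBl (oz y) // subr0.
apply: (le_trans (cauchy_schwarz _ _)).
by rewrite lecR ler_wpM2r ?nsq_ge0 // ltW.
Qed.

End closed_subspaces.

(** * Orthogonal projection and closed spans as double complements *)

Section projection.
Variables (R : realType) (H : hilbert R).
Implicit Types (x y z : H) (a : R[i]) (X Y A : set H).
Local Notation "''[' x , y ]" := (hdot H x y) : ring_scope.

Lemma subspaceD X x y : is_subspace X -> X x -> X y -> X (x + y).
Proof. by move=> [_ hX] Xx Xy; rewrite -[x]scale1r; apply: hX. Qed.

Lemma subspaceZ X a x : is_subspace X -> X x -> X (a *: x).
Proof. by move=> [X0 hX] Xx; rewrite -[_ *: _]addr0; apply: hX. Qed.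

Lemma subspaceB X x y : is_subspace X -> X x -> X y -> X (x - y).
Proof.
by move=> sX Xx Xy; apply: subspaceD => //; rewrite -scaleN1r; apply: subspaceZ.
Qed.

Lemma subspace_sum X (I : Type) (r : seq I) (P : pred I) (F : I -> H) :
  is_subspace X -> (forall i, P i -> X (F i)) -> X (\sum_(i <- r | P i) F i).
Proof.
move=> sX XF; apply: (big_ind X) => //; first by case: sX.
by move=> x y; exact: subspaceD.
Qed.

(** A minimising sequence for the distance to [X] is Cauchy by the parallelogram law; its limit is
    the foot of the perpendicular. *)
Lemma projection_theorem X x : closed_subspace X ->
  exists2 y, X y & oc X (x - y).
Proof.
move=> [sX cX]; have [X0 hX] := sX.
pose D := [set nsq (x - y) | y in X].
have D0 : D !=set0 by exists (nsq (x - 0)), 0.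
have lbD : has_lbound D by exists 0 => _ [y _ <-]; exact: nsq_ge0.
pose d := inf D.
have dD y : X y -> d <= nsq (x - y) by move=> Xy; apply: ge_inf => //; exists y.
have /choice[u uP] n : exists y, X y /\ nsq (x - y) < d + n.+1%:R^-1.
  have e0 : 0 < n.+1%:R^-1 :> R by rewrite invr_gt0.
  have [_ [y Xy <-]] := inf_adherent e0 (conj D0 lbD).
  by exists y.
have uB m n : nsq (u m - u n) <= 2 * (m.+1%:R^-1 + n.+1%:R^-1).
  have [[Xm um] [Xn un]] := (uP m, uP n).
  (* The midpoint of [u n] and [u m] lies in [X], so the sum term is at least [4 * d], which bounds
     the difference term. *)
  have := parallelogram (x - u n) (x - u m).
  have -> : x - u n - (x - u m) = u m - u n by rewrite opprB addrC addrA subrK.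
  have -> : x - u n + (x - u m) = (2 : R[i]) *: (x - (2^-1 : R[i]) *: (u n + u m)).
    rewrite scalerBr scalerA mulfV ?pnatr_eq0 // scale1r scaler_nat mulr2n.
    by rewrite addrACA -opprD.
  have h4 : nsq ((2 : R[i]) *: (x - (2^-1 : R[i]) *: (u n + u m)))
          = 4 * nsq (x - (2^-1 : R[i]) *: (u n + u m)).
    apply: complexI; rewrite nsqZ rmorphM rmorph_nat; congr (_ * _).
    by rewrite normr_nat -natrX.
  have := dD _ (subspaceZ 2^-1 sX (subspaceD sX Xn Xm)).
  rewrite h4; move: um un; move: (m.+1%:R^-1) (n.+1%:R^-1) (nsq _) => p q r.
  lra.
have [l ul] := nsq_cauchy_inv uB.
exists l.
  move/closedPnsq: cX; apply => e e0; have [n0 /(_ n0 (leqnn _)) h] := ul e e0.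
  by exists (u n0); [case: (uP n0)|rewrite nsqBC].
(* The factor 4 comes from |a + b|^2 <= 2(|a|^2 + |b|^2), with both squares at most [e * nsq w]. *)
move=> w Xw; apply: (@small_eq0 _ (4 * nsq w)) => e e0.
have [n0 hn0] := inv_small e0; have [n1 hn1] := ul e e0.
pose n := maxn n0 n1; have [Xn un] := uP n.
(* Moving [u n] along [w] by the projection coefficient stays in [X], so the distance cannot drop
   below [d]; [nsq_proj] turns this into a bound on the inner product. *)
have a1 : `|'[x - u n, w]| ^+ 2 <= (e * nsq w)%:C%C.
  have : 0 <= (nsq w)%:C%C * ((nsq (x - u n - ('[x - u n, w] / '[w, w]) *: w))%:C%C - d%:C%C).
    rewrite -rmorphB -rmorphM ler0c mulr_ge0 ?nsq_ge0 // subr_ge0.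
    by rewrite -addrA -opprD; apply: dD; apply: subspaceD => //; apply: subspaceZ.
  rewrite mulrBr nsq_proj addrAC subr_ge0 -!rmorphM -rmorphB => h.
  apply: le_trans h _; rewrite lecR [_ * d]mulrC -mulrBl.
  rewrite ler_wpM2r ?nsq_ge0 //.
  by have := hn0 n (leq_maxl _ _); move: un; move: (n.+1%:R^-1) => p; lra.
have a2 : `|'[u n - l, w]| ^+ 2 <= (e * nsq w)%:C%C.
  apply: le_trans (cauchy_schwarz _ _) _; rewrite lecR ler_wpM2r ?nsq_ge0 //.
  exact/ltW/hn1/leq_maxr.
have -> : x - l = (x - u n) + (u n - l) by rewrite addrA subrK.
rewrite dotDl.
have tri : `|'[x - u n, w] + '[u n - l, w]| ^+ 2 <=
   (`|'[x - u n, w]| ^+ 2 + `|'[u n - l, w]| ^+ 2) *+ 2.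
  apply: le_trans (_ : (`|'[x - u n, w]| + `|'[u n - l, w]|) ^+ 2 <= _).
    by rewrite lerXn2r ?nnegrE ?addr_ge0 // ler_normD.
  rewrite -subr_ge0; set p := `|_|; set q := `|_|.
  rewrite (_ : _ - _ = (p - q) ^+ 2); last by ring.
  by rewrite real_exprn_even_ge0 // rpredB ?normr_real.
apply: le_trans tri _; rewrite (_ : e * _ = (e * nsq w + e * nsq w) *+ 2); last by ring.
by rewrite rmorphMn rmorphD lerMn2r /= lerD.
Qed.

Lemma oc_sub A Y : A `<=` Y -> oc Y `<=` oc A.
Proof. by move=> AY x oY y /AY; exact: oY. Qed.

Lemma sub_oc2 A : A `<=` oc (oc A).
Proof. by move=> x Ax y /(_ x Ax) /dot_eq0C. Qed.

Lemma oc2 X : closed_subspace X -> oc (oc X) = X.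
Proof.
move=> cX; apply/seteqP; split; last exact: sub_oc2.
move=> x ox; have [y Xy oy] := projection_theorem x cX.
suff -> : x = y by [].
apply/eqP; rewrite -subr_eq0; apply/eqP/dot_eq0.
by rewrite dotBr (oy y Xy) (dot_eq0C (ox _ oy)) subr0.
Qed.

Lemma cspan_min A X : closed_subspace X -> A `<=` X -> cspan A `<=` X.
Proof. by move=> cX AX; apply: smallest_sub. Qed.

Lemma cspan_sub A : A `<=` cspan A.
Proof. exact: sub_gen_smallest. Qed.

(** Closed spans are handled from here on by orthogonality alone. *)
Lemma cspanE A : cspan A = oc (oc A).
Proof.
apply/seteqP; split.
  by apply: cspan_min; [exact: oc_closed|exact: sub_oc2].
move=> x ox X [cX AX]; rewrite -(oc2 cX) => y oy; apply: ox.
exact: oc_sub oy.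
Qed.

Lemma cspan_closed A : closed_subspace (cspan A).
Proof. by rewrite cspanE; exact: oc_closed. Qed.

Lemma oc_cspan A : oc (cspan A) = oc A.
Proof.
apply/seteqP; split; first by apply: oc_sub; exact: cspan_sub.
by rewrite cspanE; exact: sub_oc2.
Qed.

Lemma cspan_mono A Y : A `<=` cspan Y -> cspan A `<=` cspan Y.
Proof. by move=> AY; apply: cspan_min AY; exact: cspan_closed. Qed.

Lemma cspan_id X : closed_subspace X -> cspan X = X.
Proof. by move=> cX; rewrite cspanE oc2. Qed.

(** The main device for identifying a span [X]: project a vector of [Y] onto [X] and show that the
    remainder vanishes. *)
Lemma sub_closed_eq X Y : closed_subspace X -> X `<=` Y -> is_subspace Y ->
  (forall x, Y x -> oc X x -> x = 0) -> X = Y.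
Proof.
move=> cX XY sY XY0; apply/seteqP; split=> // x Yx.
have [y Xy oy] := projection_theorem x cX.
have /XY0/(_ oy)/eqP : Y (x - y) by apply: subspaceB => //; exact: XY.
by rewrite subr_eq0 => /eqP ->.
Qed.

End projection.

(** * Adjoints, closed subspaces defined by operators, orthonormal bases *)

Section adjoints.
Variables (R : realType) (H : hilbert R).
Implicit Types (x y z : H) (a : R[i]) (X Y A : set H).
Local Notation "''[' x , y ]" := (hdot H x y) : ring_scope.

(** Explicit pairs let sums and composites have adjoints with no boundedness argument; only
    [riesz_adjoint] must construct one. *)
Definition adjoint_pair (T T' : H -> H) := forall x y, '[T x, y] = '[x, T' y].

Lemma adjoint_sym T T' : adjoint_pair T T' -> adjoint_pair T' T.
Proof. by move=> TT' x y; rewrite dotC -TT' -dotC. Qed.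

(** Supplies linearity for [adj T] and for [defect], which are bare functions. *)
Lemma adjoint_linear T T' : adjoint_pair T T' -> linear T.
Proof.
move=> TT' a x y; apply: dot_inj => z; have T'T := adjoint_sym TT'.
by rewrite -T'T !dotDr !dotZr !T'T.
Qed.

Lemma adjoint0 T T' : adjoint_pair T T' -> T 0 = 0.
Proof.
by move=> TT'; apply: dot_inj => z; rewrite -(adjoint_sym TT') !dot0r.
Qed.

Lemma adjointD T T' x y : adjoint_pair T T' -> T (x + y) = T x + T y.
Proof.
by move=> /adjoint_linear TT'; have := TT' 1 x y; rewrite !scale1r.
Qed.

Lemma adjointB T T' x y : adjoint_pair T T' -> T (x - y) = T x - T y.
Proof.
move=> /adjoint_linear TT'; have := TT' (-1) y x; rewrite !scaleN1r.
by rewrite [- y + x]addrC => ->; rewrite addrC.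
Qed.

Lemma adjoint_comp T1 T1' T2 T2' : adjoint_pair T1 T1' ->
  adjoint_pair T2 T2' -> adjoint_pair (T1 \o T2) (T2' \o T1').
Proof. by move=> h1 h2 x y /=; rewrite h1 h2. Qed.

(** Riesz representation of [x |-> '[T x, y]]: the kernel is closed, and a suitable multiple of a
    vector orthogonal to it represents the functional. *)
Lemma riesz_adjoint (T : {linear H -> H}) :
  bounded_on setT T -> adjoint_pair T (adj T).
Proof.
move=> [M TM].
have [C C0 TC] : exists2 C : R, 0 <= C & forall x, nsq (T x) <= C * nsq x.
  have [K MK] : exists K : R, `|M| ^+ 2 = K%:C%C.
    by exists (complex.Re (`|M| ^+ 2)); rewrite RRe_real // realE exprn_ge0.
  exists K => [|x]; first by rewrite -ler0c -MK exprn_ge0.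
  rewrite -lecR rmorphM /= -MK.
  rewrite -!nsq_norm -exprMn lerXn2r ?nnegrE ?mulr_ge0 //.
  apply: le_trans (TM x I) _.
  rewrite -[`|x| in leRHS]normr_id -normrM real_ler_norm //.
  by apply: ger0_real; apply: le_trans (TM x I); exact: normr_ge0.
suff ex y : exists z, forall x, '[T x, y] = '[x, z].
  move=> x y; rewrite /adj /adj_on; case: xgetP => [z -> [_ ->//]|].
  by have [z Tz] := ex y => /(_ z)[]; split.
pose K := [set x | '[T x, y] = 0].
have cK : closed_subspace K.
  split; first split; first by rewrite /K /= linear0 dot0l.
    move=> a u v; rewrite /K /= linearP dotDl dotZl => -> ->.
    by rewrite mulr0 addr0.
  apply/closedPnsq => x xK; apply: (@small_eq0 _ (C * nsq y)) => e /xK[z Kz xz].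
  have -> : '[T x, y] = '[T (x - z), y] by rewrite linearB dotBl Kz subr0.
  apply: le_trans (cauchy_schwarz _ _) _; rewrite lecR mulrA.
  rewrite ler_wpM2r ?nsq_ge0 //; apply: le_trans (TC _) _.
  by rewrite mulrC ler_wpM2r // ltW.
have [oK0|] := pselect (forall u, oc K u -> u = 0).
  exists 0 => x; rewrite dot0r; suff : K x by [].
  by rewrite -(oc2 cK) => u /oK0 ->; rewrite dot0r.
move=> /existsNP[u /not_implyP[ou u0]].
have Tu0 : '[T u, y] != 0.
  by apply/eqP => Ku; apply: u0; apply: dot_eq0; apply: ou.
have uu0 : '[u, u] != 0 by apply/eqP => /dot_eq0.
(* The scalar is fixed by the value of the functional at [u]; any other [x] differs from a multiple
   of [u] by a kernel vector. *)
exists ((('[T u, y] / '[u, u])^*) *: u) => x.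
have Kx : K (x - ('[T x, y] / '[T u, y]) *: u).
  by rewrite /K /= linearB linearZ /= dotBl dotZl divfK // subrr.
have := dot_eq0C (ou _ Kx); rewrite dotBl dotZl => /eqP; rewrite subr_eq0 => /eqP.
rewrite dotZr conjCK => ->; rewrite mulrAC mulrA.
by rewrite mulfK // mulrC divfK.
Qed.

Lemma adj_on_reduced T T' X y : adjoint_pair T T' -> is_subspace X ->
  X (T' y) -> adj_on X T y = T' y.
Proof.
move=> TT' sX Xy; apply: xget_unique; first by split.
move=> z [Xz zP]; apply/eqP; rewrite -subr_eq0; apply/eqP/dot_eq0.
have Xd : X (z - T' y) by exact: subspaceB.
by rewrite dotBr -zP // TT' subrr.
Qed.

(** The preimage is the complement of the image of [oc X] under [T'], hence closed without a
    continuity argument. *)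
Lemma closed_preimage T T' X : adjoint_pair T T' -> closed_subspace X ->
  closed_subspace (T @^-1` X).
Proof.
move=> TT' cX; have -> : T @^-1` X = oc (T' @` oc X).
  apply/seteqP; split => [x Xx _ [y oy <-]|x ox].
    by rewrite -TT'; apply/dot_eq0C/oy.
  by rewrite /= -(oc2 cX) => y oy; rewrite TT'; apply: ox; exists y.
exact: oc_closed.
Qed.

Lemma cspan_maps T T' A X : adjoint_pair T T' -> closed_subspace X ->
  (forall x, A x -> X (T x)) -> forall x, cspan A x -> X (T x).
Proof.
by move=> TT' cX AX; apply: cspan_min; first exact: closed_preimage cX.
Qed.

Lemma oc_maps T T' X : adjoint_pair T T' ->
  (forall x, X x -> X (T' x)) -> forall x, oc X x -> oc X (T x).
Proof. by move=> TT' XT x ox y Xy; rewrite TT'; exact/ox/XT. Qed.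

Lemma closed_fixed T T' : adjoint_pair T T' ->
  closed_subspace [set x | T x = x].
Proof.
move=> TT'; have -> : [set x | T x = x] = oc (range (fun y => T' y - y)).
  apply/seteqP; split => [x /= Tx _ [y _ <-]|x ox].
    by rewrite dotBr -TT' Tx subrr.
  have T'T := adjoint_sym TT'.
  apply: dot_inj => y; rewrite -T'T; apply/eqP; rewrite -subr_eq0 -dotBl.
  by apply/eqP/dot_eq0C/ox; exists y.
exact: oc_closed.
Qed.

Lemma adjoint_fsum (I : Type) (r : seq I) (P : pred I) (F F' : I -> H -> H) :
  (forall i, P i -> adjoint_pair (F i) (F' i)) ->
  adjoint_pair (fun x => \sum_(i <- r | P i) F i x)
               (fun x => \sum_(i <- r | P i) F' i x).
Proof.
move=> FF' x y; rewrite dot_suml dot_sumr.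
by apply: eq_bigr => i Pi; rewrite FF'.
Qed.

Lemma closed_setI X Y : closed_subspace X -> closed_subspace Y ->
  closed_subspace (X `&` Y).
Proof.
move=> [[X0 hX] cX] [[Y0 hY] cY]; split; last exact: closedI.
by split=> // a x y [Xx Yx] [Xy Yy]; split; [exact: hX|exact: hY].
Qed.

Lemma closed_set0 : closed_subspace ([set 0] : set H).
Proof.
have -> : [set 0] = oc [set: H].
  by apply/seteqP; split=> [_ -> y _|x /(_ x I)/dot_eq0 //]; exact: dot0l.
exact: oc_closed.
Qed.

Lemma closed_kernel T T' : adjoint_pair T T' ->
  closed_subspace [set x | T x = 0].
Proof. by move=> TT'; exact: (closed_preimage TT' closed_set0). Qed.

(** Zorn's lemma gives a maximal orthonormal subset of [X]; a vector of [X] orthogonal to it could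
    be normalised and added. *)
Lemma orthonormal_basis X : closed_subspace X ->
  exists A : choiceType, hilbert_dim X A.
Proof.
move=> cX.
pose P := [set B : set H | B `<=` X /\
  forall x y, B x -> B y -> '[x, y] = (x == y)%:R].
have [|B [[BX oB] maxB]] := @Zorn_bigcup H P.
  move=> F FP tF; split; first by move=> x [B /FP[BX _] /BX].
  move=> x y [B FB Bx] [C FC Cy]; have [BC|CB] := tF _ _ FB FC.
    by have [_ ->] := FP _ FC => //; exact: BC.
  by have [_ ->] := FP _ FB => //; exact: CB.
exists {x : H | `[< B x >]}, val; split.
- by move=> [x xB] /=; apply: BX; exact/asboolP.
- by move=> [x xB] [y yB] /=; rewrite oB //; exact/asboolP.
have rB : range (val : {x : H | `[< B x >]} -> H) = B.
  apply/seteqP; split => [_ [[x xB] _ <-]|x /asboolP xB].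
    exact/asboolP.
  by exists (exist _ x xB).
rewrite rB; apply: sub_closed_eq; first exact: cspan_closed.
- exact: cspan_min.
- by case: cX.
move=> x Xx; rewrite oc_cspan => ox; apply: contrapT => x0.
have n0 : `|x| != 0 by rewrite normr_eq0; exact/eqP.
pose u := `|x|^-1 *: x.
have uu : '[u, u] = 1.
  rewrite dotZl dotZr hdotE geC0_conj ?invr_ge0 // mulrA -expr2 -exprMn.
  by rewrite mulVf // expr1n.
have uB y : B y -> '[u, y] = 0 by move=> By; rewrite dotZl ox // mulr0.
have nBu : ~ B u by move=> /uB; rewrite uu => /eqP; rewrite oner_eq0.
apply: (maxB (u |` B)).
  split; first by move=> y By; right.
  by move=> uB'; apply: nBu; apply: uB'; left.
split.
  move=> _ [->|/BX//]; apply: subspaceZ => //; by case: cX.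
have neq y : B y -> u == y = false by move=> By; apply/eqP => uy; rewrite uy in nBu.
move=> y z [->|By] [->|Bz].
- by rewrite uu eqxx.
- by rewrite uB // neq.
- by rewrite eq_sym neq // (dot_eq0C (uB _ By)).
- exact: oB.
Qed.

End adjoints.

(** * Orthonormal families and l^2 *)

Section square_summable.
Variables (R : realType) (K : choiceType) (f : K -> R[i]).

Definition sqm (k : K) : R := complex.Re `|f k| ^+ 2.

Lemma sqmC k : (sqm k)%:C%C = `|f k| ^+ 2.
Proof. by rewrite /sqm rmorphXn; congr (_ ^+ 2); apply: RRe_real. Qed.

Lemma sqm_ge0 k : 0 <= sqm k.
Proof. by rewrite -ler0c sqmC exprn_ge0. Qed.

Lemma sqr_norm2_ub (s : seq K) : uniq s ->
  ((\sum_(k <- s) sqm k)%:E <= sqr_norm2 f)%E.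
Proof.
move=> us; apply: esum_ge.
exists [set` s]; first by split.
by rewrite -fsbig_seq // sumEFin lexx.
Qed.

Lemma sqr_norm2_le (r : R) :
  (forall s : seq K, uniq s -> \sum_(k <- s) sqm k <= r) ->
  (sqr_norm2 f <= r%:E)%E.
Proof.
move=> hr; apply: ge_ereal_sup => _ [A [fA _] <-].
by rewrite fsbig_finite //= sumEFin lee_fin hr // fset_uniq.
Qed.

(** Replaces the extended real sum by a real supremum of finite sums. *)
Lemma sqr_norm2_sup : (sqr_norm2 f < +oo)%E -> exists r : R,
  [/\ sqr_norm2 f = r%:E,
      forall s, uniq s -> \sum_(k <- s) sqm k <= r
    & forall e, 0 < e -> exists2 s, uniq s & r - e < \sum_(k <- s) sqm k].
Proof.
move=> foo.
have f0 : (0 <= sqr_norm2 f)%E by apply: esum_ge0 => k _; rewrite lee_fin sqm_ge0.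
have ffin : sqr_norm2 f \is a fin_num by rewrite ge0_fin_numE.
exists (fine (sqr_norm2 f)); rewrite fineK //; split=> // [s us|e e0].
  by rewrite -lee_fin fineK // sqr_norm2_ub.
apply: contrapT => /forall2NP nex.
have : (sqr_norm2 f <= (fine (sqr_norm2 f) - e)%:E)%E.
  apply: sqr_norm2_le => s us; rewrite leNgt; apply/negP => h.
  by case: (nex s).
by rewrite -{1}(fineK ffin) lee_fin; lra.
Qed.

End square_summable.

(** * Coefficients along an orthonormal family: Bessel and Riesz-Fischer *)

Section orthonormal_model.
Variables (R : realType) (H : hilbert R) (K : choiceType).
Variables (D : set K) (b : K -> H).
Local Notation "''[' x , y ]" := (hdot H x y) : ring_scope.
Hypothesis b_on : forall k l, D k -> D l -> '[b k, b l] = (k == l)%:R.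
Implicit Types (f : K -> R[i]) (s : seq K).

(** The value 0 off [D] puts the image in [ell2 D] and lets [b] be orthonormal on [D] only. *)
Definition coef (x : H) : K -> R[i] :=
  fun k => if k \in D then '[x, b k] else 0.

Lemma coef_linear : linear coef.
Proof.
move=> a x y; apply/funext => k; rewrite /coef !fctE.
by case: ifP => _; rewrite ?dotDl ?dotZl ?scaler0 ?addr0.
Qed.

HB.instance Definition _ := GRing.isLinear.Build _ _ _ _ coef coef_linear.

Lemma coefE x k : D k -> coef x k = '[x, b k].
Proof. by move=> Dk; rewrite /coef mem_set. Qed.

Definition combo f s : H := \sum_(k <- s) f k *: b k.

Lemma dot_combo f s k : uniq s -> {in s, forall l, D l} -> D k ->
  '[combo f s, b k] = if k \in s then f k else 0.
Proof.
move=> us Ds Dk; rewrite dot_suml.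
rewrite (eq_big_seq (fun l => if l == k then f l else 0)); last first.
  by move=> l /Ds Dl; rewrite dotZl b_on //; case: eqP; rewrite ?mulr1 ?mulr0.
rewrite -big_mkcond -big_filter; case: ifPn => ks.
  by rewrite filter_pred1_uniq // big_seq1.
rewrite big1_seq // => l; rewrite mem_filter => /andP[_ /andP[/eqP -> lk]].
by rewrite lk in ks.
Qed.

Lemma nsq_combo f s : uniq s -> {in s, forall l, D l} ->
  nsq (combo f s) = \sum_(k <- s) sqm f k.
Proof.
move=> us Ds; apply: complexI; rewrite rmorph_sum /= -dotE {2}/combo dot_sumr.
apply: eq_big_seq => k ks; rewrite dotZr dot_combo ?ks //; last exact: Ds.
by rewrite mulrC -normCK sqmC.
Qed.

Lemma bessel x f s : uniq s -> {in s, forall l, D l} ->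
  {in s, forall l, f l = '[x, b l]} ->
  nsq x = nsq (x - combo f s) + \sum_(k <- s) sqm f k.
Proof.
move=> us Ds fs; rewrite -nsq_combo // -pythagoras ?subrK //.
rewrite {2}/combo dot_sumr big1_seq // => k /andP[_ ks].
by rewrite dotZr dotBl dot_combo ?ks ?fs ?subrr ?mulr0 //; exact: Ds.
Qed.

(** Finite sums over index sets [t n] that capture the total up to [n.+1%:R^-1] form a Cauchy
    sequence; its limit has the prescribed coefficients. *)
Lemma riesz_fischer f : (forall k, ~ D k -> f k = 0) ->
  (sqr_norm2 f < +oo)%E ->
  exists y, [/\ cspan (b @` D) y, coef y = f & sqr_norm2 f = (nsq y)%:E].
Proof.
move=> fD /sqr_norm2_sup[r [-> rub radh]].
have adh n : exists s, [/\ uniq s, {in s, forall l, D l}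
    & r - n.+1%:R^-1 < \sum_(k <- s) sqm f k].
  have [|s us rs] := radh n.+1%:R^-1; first by rewrite invr_gt0.
  exists [seq k <- s | k \in D]; split; first exact: filter_uniq.
    by move=> l; rewrite mem_filter => /andP[/set_mem].
  rewrite big_filter big_mkcond /= (eq_bigr (sqm f)) // => k _.
  case: ifPn => // /negP; rewrite in_setE => /fD fk.
  by rewrite /sqm fk normr0 expr0n.
have /choice[t tP] := adh.
pose u n := combo f (t n).
have tD n : {in t n, forall l, D l} by case: (tP n).
have tu n : uniq (t n) by case: (tP n).
have tr n : r - n.+1%:R^-1 < \sum_(k <- t n) sqm f k by case: (tP n).
have uB m n : nsq (u m - u n) <= 2 * (m.+1%:R^-1 + n.+1%:R^-1).
  (* Both finite sums are compared with the sum over the union, whose square norm is at most [r]. *)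
  pose w := undup (t m ++ t n); have uw : uniq w := undup_uniq _.
  have Dw : {in w, forall l, D l}.
    by move=> l; rewrite mem_undup mem_cat => /orP[] /tD.
  have near k : {subset t k <= w} -> nsq (combo f w - u k) <= k.+1%:R^-1.
    move=> kw; have := bessel (x := combo f w) (f := f) (tu k) (@tD k).
    move=> /(_ _)/wrap[].
      by move=> l lk; rewrite dot_combo ?kw //; apply: tD lk.
    rewrite nsq_combo //; have := rub w uw; have := tr k.
    by rewrite -/(u k); move: (k.+1%:R^-1) => p; lra.
  have := near n; have := near m.
  have -> : u m - u n = (combo f w - u n) - (combo f w - u m).
    by rewrite opprB [RHS]addrC addrA subrK.
  move=> /(_ _)/wrap[]; first by move=> k km; rewrite mem_undup mem_cat km.
  move=> hm /(_ _)/wrap[]; first by move=> k kn; rewrite mem_undup mem_cat kn orbT.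
  move=> hn; apply: le_trans (nsqD_le _ _) _; rewrite nsqN.
  by move: hm hn; move: (m.+1%:R^-1) (n.+1%:R^-1) => p q; lra.
have [l ul] := nsq_cauchy_inv uB.
have Xu n : cspan (b @` D) (u n).
  rewrite /u /combo big_seq; apply: (@subspace_sum _ _ (cspan (b @` D))).
    by case: (cspan_closed (b @` D)).
  move=> k /tD Dk; apply: (@subspaceZ _ _ (cspan (b @` D))); first by case: (cspan_closed (b @` D)).
  by apply: cspan_sub; exists k.
have lb k : D k -> '[l, b k] = f k.
  move=> Dk; apply/eqP; rewrite -subr_eq0; apply/eqP.
  apply: (@small_eq0 _ 1) => e e0; rewrite mulr1.
  have [n0 hn0] := ul e e0.
  pose g := sqm f k.
  (* A nonzero coefficient belongs to [t n] once [n.+1%:R^-1] is below its square modulus; otherwise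
     adding [k] would push the finite sum above [r]. *)
  have [n [n0n ukf]] : exists n, (n0 <= n)%N /\ '[u n, b k] = f k.
    have [fk0|fk0] := eqVneq (f k) 0.
      by exists n0; split=> //; rewrite dot_combo // fk0 if_same.
    have g0 : 0 < g by rewrite -ltcR sqmC exprn_gt0 // normr_gt0.
    have [n1 hn1] := inv_small g0; exists (maxn n0 n1); split; first exact: leq_maxl.
    rewrite dot_combo //; case: ifPn => // kn.
    have := rub (k :: t (maxn n0 n1)); rewrite /= kn tu => /(_ isT).
    rewrite big_cons -/g; have := hn1 _ (leq_maxr n0 n1); have := tr (maxn n0 n1).
    by move: (_.+1%:R^-1) => p *; exfalso; lra.
  rewrite -ukf -dotBl; apply: le_trans (cauchy_schwarz _ _) _.
  have -> : nsq (b k) = 1 by rewrite /nsq b_on // eqxx.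
  by rewrite mulr1 lecR nsqBC ltW // hn0.
exists l; split.
- have [_ /closedPnsq] := cspan_closed (b @` D); apply => e /ul[n0 hn0].
  by exists (u n0) => //; rewrite nsqBC; exact: hn0.
- apply/funext => k; have [Dk|nDk] := pselect (D k); first by rewrite coefE ?lb.
  by rewrite fD // /coef memNset.
congr (_%:E); apply/eqP; rewrite -subr_eq0; apply/eqP.
have ln n : nsq l = nsq (l - u n) + \sum_(k <- t n) sqm f k.
  by apply: bessel => // k /tD Dk; rewrite lb.
have small e : 0 < e -> `|r - nsq l| <= e.
  move=> e0; have [n0 hn0] := ul e e0; have [n1 hn1] := inv_small e0.
  have := hn0 _ (leq_maxl n0 n1); have := hn1 _ (leq_maxr n0 n1).
  have := tr (maxn n0 n1); have := rub _ (tu (maxn n0 n1)).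
  have := nsq_ge0 (l - u (maxn n0 n1)).
  rewrite (ln (maxn n0 n1)) nsqBC ler_norml.
  by move: (_.+1%:R^-1) => p *; apply/andP; split; lra.
apply/normr0_eq0/eqP; rewrite eq_le normr_ge0 andbT leNgt; apply/negP => h.
have /small := divr_gt0 h (ltr0n R 2); lra.
Qed.

Lemma coef_eq0 x : cspan (b @` D) x -> coef x = 0 -> x = 0.
Proof.
move=> Xx x0; apply: dot_eq0; move: Xx; rewrite cspanE; apply.
by move=> _ [k Dk <-]; rewrite -coefE // x0.
Qed.

Lemma sqr_norm2_coef_lty x : (sqr_norm2 (coef x) < +oo)%E.
Proof.
apply: (@le_lt_trans _ _ (nsq x)%:E); last exact: ltry.
apply: sqr_norm2_le => s us.
rewrite (eq_bigr (fun k => if k \in D then sqm (coef x) k else 0)); last first.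
  by move=> k _; rewrite /sqm /coef; case: ifP => //; rewrite normr0 expr0n.
rewrite -big_mkcond -big_filter.
rewrite (@bessel x (coef x) [seq k <- s | k \in D]) ?lerDr ?nsq_ge0 ?filter_uniq //.
  by move=> l; rewrite mem_filter => /andP[/set_mem].
by move=> l; rewrite mem_filter => /andP[/set_mem Dl _]; rewrite coefE.
Qed.

(** Riesz-Fischer gives surjectivity. Applied to [coef x] it also gives the norm identity, since
    injectivity identifies the vector it returns with [x]. *)
Lemma coef_unitary X : cspan (b @` D) = X -> unitary_onto_ell2 X D coef.
Proof.
move=> <-; have off x k : ~ D k -> coef x k = 0.
  by move=> nDk; rewrite /coef memNset.
have inX x y : cspan (b @` D) x -> cspan (b @` D) y -> coef x = coef y -> x = y.
  move=> Xx Xy xy; apply/eqP; rewrite -subr_eq0; apply/eqP/coef_eq0.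
    by apply: (@subspaceB _ _ (cspan (b @` D))) => //; case: (cspan_closed (b @` D)).
  by rewrite linearB /= xy subrr.
split=> [x Xx|].
  have [y [Xy yx ->]] := riesz_fischer (off x) (sqr_norm2_coef_lty x).
  by rewrite -nsqE (inX x y).
apply/seteqP; split=> [_ [x Xx <-]|f [f0 foo]].
  by split; [exact: off|exact: sqr_norm2_coef_lty].
by have [y [Xy yf _]] := riesz_fischer f0 foo; exists y.
Qed.

End orthonormal_model.

(** * Unitary equivalence with operators that move basis vectors *)

Section amplified_model.
Variables (R : realType) (H : hilbert R) (I A : choiceType).
Local Notation "''[' x , y ]" := (hdot H x y) : ring_scope.

Lemma dot_cspan_eq (B : set H) (T T' : H -> H) y w : adjoint_pair T T' ->
  (forall x, B x -> '[T x, y] = '[x, w]) ->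
  forall x, cspan B x -> '[T x, y] = '[x, w].
Proof.
move=> TT' BT x; rewrite cspanE => ox; apply/eqP.
rewrite -subr_eq0 TT' -dotBr; apply/eqP; apply: ox => z Bz.
by apply: dot_eq0C; rewrite dotBr -TT' BT // subrr.
Qed.

(** One [U] serves all operators that act on the basis through a partial injection [sigma]. The
    coefficient of [T x] at [(j, a)] is that of [x] at the preimage of [j], or 0 if there is none,
    which is checked on basis vectors. *)
Lemma ampl_model (J : set I) (b : I * A -> H) (X : set H) :
  (forall k l, ampl_dom J k -> ampl_dom J l -> '[b k, b l] = (k == l)%:R) ->
  cspan (b @` ampl_dom J) = X ->
  exists U : {linear H -> (I * A -> R[i])},
    unitary_onto_ell2 X (ampl_dom J) U /\
    forall (T T' : H -> H) (sigma : I -> option I), adjoint_pair T T' ->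
      (forall i j k, sigma i = Some k -> sigma j = Some k -> i = j) ->
      (forall i j, sigma i = Some j -> (J i <-> J j)) ->
      (forall i a, J i ->
         T (b (i, a)) = if sigma i is Some j then b (j, a) else 0) ->
      intertwines X U T (ampl (push sigma)).
Proof.
move=> b_on XE; exists (coef (ampl_dom J) b); split.
  exact: coef_unitary.
move=> T T' sigma TT' sinj sJ Tb x; rewrite -XE => Xx.
apply/funext => -[j a]; rewrite /ampl /push /=.
have [[i sij]|nsj] := pselect (exists i, sigma i = Some j).
  rewrite [X in \sum_(k \in X) _](_ : _ = [set i]); last first.
    by apply/seteqP; split => [k /= skj|k /= ->//]; exact: sinj skj sij.
  rewrite fsbig_set1; have [Jj|nJj] := pselect (J j); last first.
    by rewrite /coef !memNset //= /ampl_dom /= => /(sJ _ _ sij).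
  have Ji : J i by apply/(sJ _ _ sij).
  rewrite !coefE //; apply: (dot_cspan_eq TT') Xx => _ [[k c] Jk <-].
  rewrite Tb //; case sk : (sigma k) => [l|].
    have Jl : J l by apply/(sJ _ _ sk).
    rewrite !b_on // !xpair_eqE; congr ((_ && _)%:R).
    apply/eqP/eqP => [lj|ki]; last by apply/Some_inj; rewrite -sk ki sij.
    by apply: sinj sij; rewrite sk lj.
  rewrite dot0l b_on // xpair_eqE; case: eqP => // ki.
  by rewrite ki sij in sk.
rewrite [X in \sum_(k \in X) _](_ : _ = set0); last first.
  by apply/seteqP; split => // k skj; case: nsj; exists k.
rewrite fsbig_set0; have [Jj|nJj] := pselect (J j); last by rewrite /coef memNset.
rewrite coefE // -[RHS](dot0r x); apply: (dot_cspan_eq TT') Xx => _ [[k c] Jk <-].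
rewrite Tb // dot0r; case sk : (sigma k) => [l|]; last by rewrite dot0l.
have Jl : J l by apply/(sJ _ _ sk).
rewrite b_on // xpair_eqE; case: eqP => // lj.
by case: nsj; exists k; rewrite sk lj.
Qed.

End amplified_model.

(** * Self-similar graphs *)

Section self_similar_graphs.
Variables (E : graph) (N : self_similar E).
Implicit Types (p q : nat) (v w : vert E) (e : edge E) (l : seq (edge E)).

Lemma actv_inj p : injective (actv N p).
Proof. exact: bij_inj (actv_bij N p). Qed.

Lemma acte_inj p : injective (acte N p).
Proof. exact: bij_inj (acte_bij N p). Qed.

Lemma act_inj p : injective (act N p).
Proof. by move=> [v|e] [w|f] //= [] => [/actv_inj|/acte_inj] ->. Qed.

Lemma actv_surj p v : exists w, actv N p w = v.
Proof. by have [g _ gK] := actv_bij N p; exists (g v). Qed.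

Lemma acte_surj p e : exists f, acte N p f = e.
Proof. by have [g _ gK] := acte_bij N p; exists (g e). Qed.

(** The semigroup law makes [act N 0] idempotent, and injectivity turns it into the identity. *)
Lemma act0 g : act N 0 g = g.
Proof. by apply: (@act_inj 0); rewrite -actD. Qed.

Lemma actv0 v : actv N 0 v = v.
Proof. by have [] := act0 (inl v). Qed.

Lemma actvD p q v : actv N (p + q) v = actv N p (actv N q v).
Proof. by have [] := actD N p q (inl v). Qed.

Lemma res0 g : res N 0 g = 0%N.
Proof. by case: g => [v|e]; rewrite ?res_vert ?res0_edge. Qed.

Lemma act_iter p g : act N p g = iter p (act N 1) g.
Proof. by elim: p => [|p IH]; [rewrite act0|rewrite -add1n actD IH]. Qed.

Lemma actM_fix p g j : act N p g = g ->
  act N (j * p) g = g /\ res N (j * p) g = (j * res N p g)%N.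
Proof.
move=> pg; elim: j => [|j [IH1 IH2]]; first by rewrite act0 res0.
by rewrite mulSn actD resD IH1 pg IH2 mulSn.
Qed.

(** The graph is finite, so the factorial of the number of vertices and edges is a multiple of every
    cycle length. *)
Lemma act_period : exists2 k, (0 < k)%N & forall g, act N k g = g.
Proof.
exists (#|{: gen E}|)`!; first exact: fact_gt0.
move=> g; have ord_le : (order (act N 1) g <= #|{: gen E}|)%N by exact: max_card.
have /dvdnP[j ->] : (order (act N 1) g %| (#|{: gen E}|)`!)%N.
  by rewrite dvdn_fact // order_gt0.
have [] // := @actM_fix (order (act N 1) g) g j.
by rewrite act_iter iter_order //; exact: act_inj.
Qed.

(** Restriction is additive along multiples of a [p] fixing [e], so a single nonzero value can be
    multiplied up. *)
Lemma res_unbounded e n : (exists m, res N m (inr e) <> 0%N) ->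
  exists2 p, act N p (inr e) = inr e & (n <= res N p (inr e))%N.
Proof.
move=> [m rm]; have [k k0 kg] := act_period.
have [mke _] := actM_fix m (kg (inr e)).
(* Splitting [m * k] as [m * k.-1 + m] leaves the nonzero restriction of [m] as a summand. *)
have r1 : (0 < res N (m * k) (inr e))%N.
  case: k k0 {kg mke} => // k _; rewrite mulnS addnC resD ltn_addl //.
  by rewrite lt0n; apply/eqP.
have [h1 h2] := actM_fix n mke.
by exists (n * (m * k))%N; rewrite // h2 leq_pmulr.
Qed.

Lemma vorbit_refl v : vorbit N v v.
Proof. by exists 0%N => //; exact: actv0. Qed.

Lemma vorbit_act v w p : vorbit N v w -> vorbit N v (actv N p w).
Proof. by move=> [q _ <-]; exists (p + q)%N => //; exact: actvD. Qed.

(** By periodicity some multiple of [p] acts trivially, so [p.w] can be moved back to [w]; this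
    makes orbits equivalence classes. *)
Lemma vorbit_inv v w p : vorbit N v (actv N p w) -> vorbit N v w.
Proof.
move=> vpw; have [k k0 kg] := act_period.
have : vorbit N v (actv N (p * k) w).
  case: k k0 {kg} => // k _; rewrite mulnS addnC actvD; exact: vorbit_act.
by have [[->] _] := actM_fix p (kg (inl w)).
Qed.

Lemma vorbit_sym v w : vorbit N v w -> vorbit N w v.
Proof. by move=> [p _ <-]; apply: (@vorbit_inv _ _ p); exact: vorbit_refl. Qed.

Lemma vorbit_eq v w : vorbit N v w -> vorbit N v = vorbit N w.
Proof.
move=> vw; apply/seteqP; split=> u.
  by move=> [p _ <-]; apply: vorbit_act; exact: vorbit_sym.
by move=> [p _ <-]; exact: vorbit_act.
Qed.

Lemma act_edges_surj p l : exists l', act_edges N p l' = l.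
Proof.
elim: l p => [|e l IH] p; first by exists [::].
have [f fe] := acte_surj p e; have [l' l'l] := IH (res N p (inr f)).
by exists (f :: l'); rewrite /= fe l'l.
Qed.

Lemma act_edges_inj p : injective (act_edges N p).
Proof.
move=> l l'; elim: l l' p => [|e l IH] [|f l'] p //= [/acte_inj <-] /IH -> //.
Qed.

Lemma gpath_eq (mu nu : gpath E) :
  prange mu = prange nu -> pedges mu = pedges nu -> mu = nu.
Proof.
by move=> r e; apply: val_inj; apply: injective_projections.
Qed.

Lemma gpath_source_eq (mu nu : gpath E) :
  psource mu = psource nu -> pedges mu = pedges nu -> mu = nu.
Proof.
move=> sE eE; apply: gpath_eq => //; have := gvalP mu; have := gvalP nu.
move: sE eE; rewrite /psource /pedges /prange.
case: (gval mu) (gval nu) => [v l] [w m] /= + lm; rewrite -{}lm.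
by case: l => [//|e l] /= _ /andP[/eqP -> _] /andP[/eqP -> _].
Qed.

Lemma act_path_inj p : injective (act_path N p).
Proof.
by move=> mu nu [] /actv_inj r /act_edges_inj l; exact: gpath_eq.
Qed.

(** By [res_act_sr], [p] and its restriction to an edge agree at the source of that edge, so the
    restriction accumulated along the path moves its source. *)
Lemma psource_act p (mu : gpath E) :
  psource (act_path N p mu) = actv N (res_path N p mu) (psource mu).
Proof.
case: mu => -[w l] /= wl; rewrite /psource /res_path /= /prange /pedges /=.
elim: l w p wl => [//|e l IH] w p /= /andP[_ wl].
by rewrite act_sr -res_act_sr IH.
Qed.

End self_similar_graphs.

(** * Polarisation and isometries *)

Section isometries.
Variables (R : realType) (H : hilbert R).
Local Notation "''[' x , y ]" := (hdot H x y) : ring_scope.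

(** Polarisation over the complex numbers: the form is evaluated at [x + y] and ['i *: x + y] with
    [y = T x]. *)
Lemma quadratic_form_eq0 (T T' : H -> H) : adjoint_pair T T' ->
  (forall x, '[T x, x] = 0) -> forall x, T x = 0.
Proof.
move=> TT' T0 x; apply/dot_eq0; set y := T x.
have lT := adjoint_linear TT'.
have := T0 (1 *: x + y); rewrite lT !scale1r dotDl !dotDr !T0 addr0 add0r => h1.
have := T0 ('i *: x + y); rewrite lT dotDl !dotDr !dotZl !dotZr !T0.
rewrite !mulr0 addr0 add0r conjCi => h2.
have /eqP : 'i * ('[T x, y] * 2) = 0 :> R[i].
  rewrite -[RHS]h2 -[RHS](addr0 _) -[X in _ + X](mulr0 'i) -h1; ring.
by rewrite mulf_eq0 (negPf (neq0Ci _)) mulf_eq0 pnatr_eq0 orbF => /eqP.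
Qed.

Lemma isometry_adjointK (T T' : H -> H) : adjoint_pair T T' ->
  (forall x, `|T x| = `|x|) -> forall x, T' (T x) = x.
Proof.
move=> TT' iT x; apply/eqP; rewrite -subr_eq0; apply/eqP.
have T'T := adjoint_sym TT'.
apply: (@quadratic_form_eq0 (fun x => T' (T x) - x) (fun x => T' (T x) - x)).
  by move=> y z; rewrite dotBl dotBr T'T TT'.
by move=> y; rewrite dotBl T'T !hdotE iT subrr.
Qed.

End isometries.

(** * Toeplitz-Cuntz-Krieger families *)

Section TCK_families.
Variables (R : realType) (H : hilbert R) (E : graph).
Variables (S : gen E -> {linear H -> H}).
Hypothesis hS : TCK_on S setT.
Local Notation "''[' x , y ]" := (hdot H x y) : ring_scope.
Local Notation P v := (S (inl v)).
Local Notation s e := (S (inr e)).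
Local Notation s' e := (adj (S (inr e))).
Implicit Types (v w : vert E) (e f : edge E) (x y z : H) (l : seq (edge E)).

Lemma S_adjoint g : adjoint_pair (S g) (adj (S g)).
Proof. by apply: riesz_adjoint; have [/(_ g)[]] := hS. Qed.

Lemma P_adj v x : adj (P v) x = P v x.
Proof. by have [_ /(_ v x I)[]] := hS. Qed.

Lemma P_adjoint v : adjoint_pair (P v) (P v).
Proof. by move=> x y; rewrite S_adjoint P_adj. Qed.

Lemma PP v w x : P v (P w x) = if v == w then P v x else 0.
Proof.
have [_ hP hPP _ _] := hS; case: eqP => [->|vw]; last exact: hPP.
by have [] := hP w x I.
Qed.

Lemma s'sK e x : s' e (s e x) = P (sr e) x.
Proof. by have [_ _ _ h _] := hS; exact: h. Qed.

Lemma nsq_s e x : nsq (s e x) = nsq (P (sr e) x).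
Proof.
by rewrite /nsq S_adjoint s'sK [in RHS]P_adjoint PP eqxx.
Qed.

Lemma sPE e w x : s e (P w x) = if sr e == w then s e x else 0.
Proof.
have sP z : P (sr e) z = 0 -> s e z = 0.
  by move=> Pz; apply: nsq_eq0; rewrite nsq_s Pz nsq0.
case: eqP => [<-|/eqP/negPf ew]; last by apply: sP; rewrite PP ew.
apply/eqP; rewrite -subr_eq0 -linearB; apply/eqP/sP.
by rewrite linearB /= PP eqxx subrr.
Qed.

Lemma nsq_P v x : nsq x = nsq (P v x) + nsq (x - P v x).
Proof.
rewrite -pythagoras; first by rewrite addrC subrK.
by rewrite dotBr !P_adjoint PP eqxx subrr.
Qed.

(* The range projections of the edges into v are dominated by P v, and their
   quadratic forms at y = s f z already exhaust |y|^2 with the term e = f. *)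
Lemma sum_nsq_s' f z :
  \sum_(e : edge E | (rg e == rg f) && (e != f)) nsq (s' e (s f z))
    + nsq (s f z - P (rg f) (s f z)) <= 0.
Proof.
have [_ _ _ _ /(_ (rg f) (s f z) I)] := hS.
rewrite dot_suml (eq_bigr (fun e => (nsq (s' e (s f z)))%:C%C)); last first.
  by move=> e _; rewrite S_adjoint dotE.
have -> : '[P (rg f) (s f z), s f z] = (nsq (P (rg f) (s f z)))%:C%C.
  by rewrite -dotE -[in RHS]P_adjoint PP eqxx.
rewrite -rmorph_sum lecR (bigD1 f) //= s'sK -nsq_s.
by have := nsq_P (rg f) (s f z); lra.
Qed.

(** Both summands of [sum_nsq_s'] are nonnegative, so the second one vanishes. *)
Lemma P_rg f z : P (rg f) (s f z) = s f z.
Proof.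
apply/eqP; rewrite eq_sym -subr_eq0; apply/eqP/nsq_eq0/eqP.
rewrite eq_le nsq_ge0 andbT; apply: le_trans (sum_nsq_s' f z).
by rewrite lerDr sumr_ge0 // => e _; exact: nsq_ge0.
Qed.

Lemma PsE w e x : P w (s e x) = if w == rg e then s e x else 0.
Proof. by rewrite -P_rg PP; case: eqP => [->|//]; rewrite P_rg. Qed.

Lemma s'PE e w x : s' e (P w x) = if w == rg e then s' e x else 0.
Proof.
apply: dot_inj => z; rewrite -S_adjoint -P_adjoint PsE.
by case: eqP => _; rewrite ?S_adjoint // dot0l dot0r.
Qed.

Lemma Ps'E w e x : P w (s' e x) = if sr e == w then s' e x else 0.
Proof.
apply: dot_inj => z; rewrite -P_adjoint -S_adjoint sPE.
by case: eqP => _; rewrite ?S_adjoint // dot0l dot0r.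
Qed.

(** Edges with different ranges are separated by the vertex projections; for distinct edges with the
    same range, the term of index [e] in [sum_nsq_s'] must be 0. *)
Lemma s'sE e f x : s' e (s f x) = if e == f then P (sr f) x else 0.
Proof.
case: eqP => [->|/eqP ef]; first exact: s'sK.
have [rf|rf] := eqVneq (rg e) (rg f); last first.
  by rewrite -P_rg s'PE eq_sym (negPf rf).
apply/nsq_eq0/eqP; rewrite eq_le nsq_ge0 andbT.
apply: le_trans (sum_nsq_s' f x).
rewrite (bigD1 e) ?rf ?eqxx //= -addrA lerDl addr_ge0 ?nsq_ge0 //.
by rewrite sumr_ge0 // => i _; exact: nsq_ge0.
Qed.

Local Notation D v := (defect S v).

Lemma D_adjoint v : adjoint_pair (D v) (D v).
Proof.
move=> x y; rewrite /defect dotBl dotBr P_adjoint dot_suml dot_sumr.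
congr (_ - _); apply: eq_bigr => e _.
by rewrite S_adjoint (adjoint_sym (S_adjoint _)).
Qed.

Lemma Ds v e x : D v (s e x) = 0.
Proof.
rewrite /defect PsE; case: eqP => [->|ve].
  rewrite (bigD1 e) //= big1 ?addr0.
    by rewrite s'sE eqxx sPE eqxx subrr.
  by move=> f /andP[_ fe]; rewrite s'sE (negPf fe) linear0.
rewrite big1 ?subrr // => f /eqP rf; rewrite s'sE; case: eqP => fe.
  by case: ve; rewrite -fe.
by rewrite linear0.
Qed.

Lemma s'D e v x : s' e (D v x) = 0.
Proof.
by apply: dot_inj => z; rewrite -S_adjoint -D_adjoint Ds dot0l dot0r.
Qed.

Lemma PD w v x : P w (D v x) = if w == v then D v x else 0.
Proof.
rewrite /defect linearB linear_sum /= PP.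
under eq_bigr => e /eqP re do rewrite PsE re.
by case: eqP => [->//|_]; rewrite big1 ?subrr.
Qed.

Lemma DP v w x : D v (P w x) = if v == w then D v x else 0.
Proof.
apply: dot_inj => z; rewrite -D_adjoint -P_adjoint PD eq_sym.
by case: eqP => _; rewrite ?D_adjoint // dot0l dot0r.
Qed.

Lemma DD v w x : D v (D w x) = if v == w then D v x else 0.
Proof.
rewrite -DP {2}/defect (adjointB _ _ (D_adjoint v)).
suff -> : D v (\sum_(e | rg e == w) s e (s' e x)) = 0 by rewrite subr0.
elim/big_rec: _ => [|e y _ IH]; first exact: adjoint0 (D_adjoint v).
by rewrite (adjointD _ _ (D_adjoint v)) Ds IH addr0.
Qed.

(* S_mu for mu = l.  The list l need not be a path: if it is not, SL l = 0, so
   no walk hypothesis has to be carried along. *)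
Definition SL l x : H := foldr (fun e y => s e y) x l.

(** The adjoint removes the first edge first, hence a left fold. *)
Definition SA l x : H := foldl (fun y e => s' e y) x l.

Lemma SL_adjoint l : adjoint_pair (SL l) (SA l).
Proof.
by elim: l => [//|e l IH] x y; rewrite /= S_adjoint IH.
Qed.

Lemma SL_source l w x : walk w l ->
  SL l (P (last w (map (@sr E) l)) x) = P w (SL l x).
Proof.
elim: l w => [//|e l IH] w /= /andP[/eqP <- wl].
by rewrite IH // sPE P_rg eqxx.
Qed.

Lemma SpathE mu x : Spath S mu x = SL (pedges mu) (P (psource mu) x).
Proof.
have wm := gvalP mu; rewrite /psource SL_source // /Spath /pedges /prange.
case: (gval mu) wm => w [|e l] //= /andP[/eqP <- _].
by rewrite P_rg.
Qed.

Lemma Spath_range mu x : Spath S mu x = P (prange mu) (SL (pedges mu) x).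
Proof. by rewrite SpathE SL_source //; exact: (gvalP mu). Qed.

(** A prepended edge either matches the range of the path or is annihilated by [sPE]. Spans over
    paths can thus be replaced by spans over all edge lists. *)
Lemma SL_cases l v :
  (exists2 mu, pedges mu = l & psource mu = v) \/
  (forall x, SL l (P v x) = 0).
Proof.
elim: l => [|e l [[mu mul muv]|IH]].
- by left; exists (@GPath E (v, [::]) isT).
- have [re|re] := eqVneq (sr e) (prange mu); last first.
    right=> x /=; rewrite -mul -muv SL_source; last exact: (gvalP mu).
    by rewrite sPE (negPf re).
  have we : walk (rg e) (e :: l) by rewrite /= eqxx re -mul; exact: (gvalP mu).
  left; exists (@GPath E (rg e, e :: l) we) => //.
  by rewrite /psource /= -mul re.
- by right=> x /=; rewrite IH linear0.
Qed.

Lemma SL0 l : SL l 0 = 0.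
Proof. exact: adjoint0 (SL_adjoint l). Qed.

Lemma SL_W_cases l v x : D v x = x ->
  (exists2 mu, psource mu = v & SL l x = Spath S mu x) \/ SL l x = 0.
Proof.
move=> Dx; have Px : P v x = x by rewrite -Dx PD eqxx.
have [[mu mul muv]|h] := SL_cases l v; last by right; rewrite -Px h.
by left; exists mu => //; rewrite SpathE mul muv Px.
Qed.

(** Common leading edges cancel; then either two different edges meet or one list is exhausted and
    [s'D] applies. *)
Lemma SL_orth l l' v w x y : D v x = x -> D w y = y -> l <> l' ->
  '[SL l x, SL l' y] = 0.
Proof.
move=> Dx Dy; elim: l l' => [|e l IH] [|f l'] //= ll'.
- by apply: dot_eq0C; rewrite S_adjoint -Dx s'D dot0r.
- by rewrite S_adjoint -Dy s'D dot0r.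
rewrite S_adjoint s'sE; case: eqP => ef; last by rewrite dot0r.
have {ll'} ll' : l <> l' by move=> ll; apply: ll'; rewrite ef ll.
(* Cancelling an edge leaves a vertex projection in front of [SL S l' y], which either fixes or
   kills it. *)
case: l' ll' {IH}(IH _ ll') => [|g l'] _ IH /=.
  rewrite -Dy PD; case: eqP => _; last by rewrite dot0r.
  by rewrite Dy.
by rewrite PsE; case: eqP => _; rewrite ?dot0r.
Qed.

Lemma SA_SL l w x : walk w l ->
  SA l (SL l (P (last w (map (@sr E) l)) x)) = P (last w (map (@sr E) l)) x.
Proof.
elim: l w => [//|e l IH] w /= /andP[_ wl].
by rewrite s'sK -SL_source // PP eqxx IH.
Qed.

Lemma Spath_isometry mu x y :
  '[Spath S mu x, Spath S mu y] = '[P (psource mu) x, y].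
Proof.
rewrite !SpathE -(adjoint_sym (SL_adjoint _)).
rewrite SA_SL; last exact: (gvalP mu).
by rewrite P_adjoint PP eqxx -P_adjoint.
Qed.

End TCK_families.

Lemma cspan0 (R : realType) (H : hilbert R) (A : set H) : cspan A 0.
Proof. by have [[]] := cspan_closed A. Qed.

(** * Wold decomposition of a Toeplitz-Cuntz-Krieger family *)

Section TCK_wold.
Variables (R : realType) (H : hilbert R) (E : graph).
Variables (S : gen E -> {linear H -> H}).
Hypothesis hS : TCK_on S setT.
Local Notation "''[' x , y ]" := (hdot H x y) : ring_scope.
Local Notation P v := (S (inl v)).
Local Notation s e := (S (inr e)).
Local Notation s' e := (adj (S (inr e))).
Local Notation D v := (defect S v).
Implicit Types (v w : vert E) (e f : edge E) (x y z : H) (l : seq (edge E)).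
Implicit Types (Q : set (vert E)) (X : set H).

(** One span for a set of vertices covers both [H_] and [H_orb]; lists that form no path with source
    [v] contribute only 0. *)
Definition shift_span Q : set H :=
  cspan [set x | exists l v y, Q v /\ x = SL S l (D v y)].

Lemma shift_span_closed Q : closed_subspace (shift_span Q).
Proof. exact: cspan_closed. Qed.

Lemma shift_span_gen Q l v y : Q v -> shift_span Q (SL S l (D v y)).
Proof. by move=> Qv; apply: cspan_sub; exists l, v, y. Qed.

Lemma shift_span0 Q : shift_span Q 0.
Proof. exact: cspan0. Qed.

(** Moving [SL] and [D v] across the inner product turns orthogonality into equations, the form in
    which it is tested later. *)
Lemma oc_shift_spanP Q x : oc (shift_span Q) x <->
  forall l v, Q v -> D v (SA S l x) = 0.
Proof.
rewrite oc_cspan; split=> [ox l v Qv|h _ [l [v [y [Qv ->]]]]].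
  apply: dot_inj => y; rewrite -(D_adjoint hS) -(SL_adjoint hS) dot0r.
  by apply: dot_eq0C; apply: ox; exists l, v, y.
by rewrite -(adjoint_sym (SL_adjoint hS l)) -(D_adjoint hS) h // dot0l.
Qed.

Lemma shift_span_mono Q Q' : Q `<=` Q' -> shift_span Q `<=` shift_span Q'.
Proof.
move=> QQ'; apply: cspan_mono => _ [l [v [y [Qv ->]]]].
by apply: (@shift_span_gen Q'); exact: QQ'.
Qed.

Lemma SL_D_orth l l' v w x y : v <> w -> '[SL S l (D v x), SL S l' (D w y)] = 0.
Proof.
move=> vw; have Dx : D v (D v x) = D v x by rewrite DD // eqxx.
have Dy : D w (D w y) = D w y by rewrite DD // eqxx.
have [<-{l'}|/eqP ll'] := eqVneq l l'; last exact: (SL_orth hS Dx Dy).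
elim: l => [|e l IH] /=.
  by rewrite (D_adjoint hS) DD //; case: eqP => // _; rewrite dot0r.
rewrite (S_adjoint hS) s'sK //; case: l IH => [|f l] /= IH.
  by rewrite PD //; case: eqP => _; rewrite ?dot0r.
by rewrite PsE //; case: eqP => _; rewrite ?dot0r.
Qed.

Lemma shift_span_orth Q Q' : Q `&` Q' = set0 ->
  orthogonal_sets (shift_span Q) (shift_span Q').
Proof.
move=> QQ' x y Qx Qy; apply: dot_eq0C.
suff : oc (shift_span Q) y by apply.
move: Qy; apply: cspan_min => [|_ [l [v [{}y [Qv ->]]]]]; first exact: oc_closed.
rewrite /= oc_cspan => _ [l' [v' [z [Qv' ->]]]].
apply: SL_D_orth => vv'; have : (Q `&` Q') v by split=> //; rewrite vv'.
by rewrite QQ'.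
Qed.

Lemma H_E v : H_ S v = shift_span [set v].
Proof.
apply/seteqP; split; apply: cspan_mono.
  move=> _ [mu _ [_ [y _ <-] <-]]; rewrite SpathE // PD //.
  case: eqP => _; last by rewrite SL0 //; exact: shift_span0.
  exact: shift_span_gen.
move=> _ [l [_ [y [-> ->]]]].
have Dy : D v (D v y) = D v y by rewrite DD // eqxx.
have [[mu _ ->]|->] := SL_W_cases hS l Dy; last exact: cspan0.
by apply: cspan_sub; exists mu => //; exists (D v y) => //; exists y.
Qed.

Lemma H_orbE Q : H_orb S Q = shift_span Q.
Proof.
apply/seteqP; split; apply: cspan_mono.
  move=> x [v Qv]; rewrite H_E; apply: shift_span_mono.
  by move=> _ ->.
move=> _ [l [v [y [Qv ->]]]]; apply: cspan_sub; exists v => //.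
by rewrite H_E; exact: shift_span_gen.
Qed.

Lemma shift_span_P Q w x : shift_span Q x -> shift_span Q (P w x).
Proof.
apply: (cspan_maps (P_adjoint hS w) (shift_span_closed Q)).
move=> _ [[|e l] [v [y [Qv ->]]]] /=.
  rewrite PD //; case: eqP => _; last exact: shift_span0.
  exact: (@shift_span_gen Q [::]).
rewrite PsE //; case: eqP => _; last exact: shift_span0.
exact: (@shift_span_gen Q (e :: l)).
Qed.

Lemma shift_span_s Q e x : shift_span Q x -> shift_span Q (s e x).
Proof.
apply: (cspan_maps (S_adjoint hS _) (shift_span_closed Q)).
by move=> _ [l [v [y [Qv ->]]]]; exact: (@shift_span_gen Q (e :: l)).
Qed.

Lemma shift_span_s' Q e x : shift_span Q x -> shift_span Q (s' e x).
Proof.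
apply: (cspan_maps (adjoint_sym (S_adjoint hS _)) (shift_span_closed Q)).
move=> _ [[|f l] [v [y [Qv ->]]]] /=.
  by rewrite s'D //; exact: shift_span0.
rewrite s'sE //; case: eqP => _; last exact: shift_span0.
by apply: shift_span_P; exact: shift_span_gen.
Qed.

Definition S_invariant X :=
  forall g x, X x -> X (S g x) /\ X (adj (S g) x).

Lemma shift_span_S Q : S_invariant (shift_span Q).
Proof.
move=> [v|e] x Qx; first by rewrite P_adj //; split; exact: shift_span_P.
by split; [exact: shift_span_s|exact: shift_span_s'].
Qed.

Definition Psum x : H := \sum_(v : vert E) P v x.

Lemma Psum_adjoint : adjoint_pair Psum Psum.
Proof. by apply: adjoint_fsum => v _; exact: P_adjoint. Qed.

Lemma P_Psum v x : P v (Psum x) = P v x.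
Proof.
rewrite linear_sum (bigD1 v) //= PP // eqxx big1 ?addr0 // => w wv.
by rewrite PP // eq_sym (negPf wv).
Qed.

Lemma Psum_P v x : Psum (P v x) = P v x.
Proof.
rewrite /Psum (bigD1 v) //= PP // eqxx big1 ?addr0 // => w wv.
by rewrite PP // (negPf wv).
Qed.

Lemma Psum_s e x : Psum (s e x) = s e x.
Proof. by rewrite -P_rg // Psum_P. Qed.

Lemma Psum_s' e x : Psum (s' e x) = s' e x.
Proof.
have <- : P (sr e) (s' e x) = s' e x by rewrite Ps'E // eqxx.
exact: Psum_P.
Qed.

Lemma Psum_D v x : Psum (D v x) = D v x.
Proof.
have <- : P v (D v x) = D v x by rewrite PD // eqxx.
exact: Psum_P.
Qed.

Lemma essentialE : essential S = [set x | Psum x = x].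
Proof.
apply/seteqP; split=> [_ [x _ <-]|x /= <-]; last by exists x.
by rewrite /= -/(Psum x) {1}/Psum; apply: eq_bigr => v _; rewrite P_Psum.
Qed.

Lemma essential_closed : closed_subspace (essential S).
Proof. by rewrite essentialE; apply: closed_fixed; exact: Psum_adjoint. Qed.

Lemma essential_S : S_invariant (essential S).
Proof.
rewrite essentialE => -[v|e] x /= Qx; first by rewrite P_adj // Psum_P.
by rewrite Psum_s Psum_s'.
Qed.

Lemma shift_span_essential Q : shift_span Q `<=` essential S.
Proof.
apply: cspan_min; first exact: essential_closed.
rewrite essentialE => _ [[|e l] [v [y [_ ->]]]] /=; first exact: Psum_D.
exact: Psum_s.
Qed.

(* The projection onto the span of the ranges of the S_mu with |mu| = d. *)
Fixpoint Plen d x : H :=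
  if d is d'.+1 then \sum_(e : edge E) s e (Plen d' (s' e x)) else Psum x.

Lemma Plen_adjoint d : adjoint_pair (Plen d) (Plen d).
Proof.
elim: d => [|d IH]; first exact: Psum_adjoint.
apply: adjoint_fsum => e _ x y.
by rewrite S_adjoint // IH (adjoint_sym (S_adjoint hS _)).
Qed.

Lemma P_Plen d w x : P w (Plen d.+1 x) = Plen d.+1 (P w x).
Proof.
rewrite /= linear_sum; apply: eq_bigr => e _.
rewrite PsE // s'PE //; case: eqP => // _.
by rewrite (adjoint0 (Plen_adjoint d)) linear0.
Qed.

Lemma s'_Plen d e x : s' e (Plen d.+1 x) = P (sr e) (Plen d (s' e x)).
Proof.
rewrite /=.
have := adjoint_sym (S_adjoint hS (inr e)) => ss'.
have sumE (r : seq (edge E)) (F : edge E -> H) :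
  s' e (\sum_(f <- r) F f) = \sum_(f <- r) s' e (F f).
  elim: r => [|f r IH]; first by rewrite !big_nil (adjoint0 ss').
  by rewrite !big_cons (adjointD _ _ ss') IH.
rewrite sumE (bigD1 e) //= s'sK // big1 ?addr0 // => f fe.
by rewrite s'sE // eq_sym (negPf fe).
Qed.

Lemma Plen_SL l w x : walk w l ->
  Plen (size l) (P w (SL S l x)) = P w (SL S l x).
Proof.
elim: l w => [|e l IH] w /=; first by rewrite Psum_P.
move=> /andP[/eqP <- wl]; rewrite P_rg // (bigD1 e) //= s'sK // IH //.
rewrite sPE // eqxx big1 ?addr0 // => f fe.
by rewrite s'sE // (negPf fe) (adjoint0 (Plen_adjoint _)) linear0.
Qed.

Lemma Plen_span d x :
  cspan (\bigcup_(mu in [set mu | plen mu = d]) range (Spath S mu)) (Plen d x).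
Proof.
elim: d x => [|d IH] x /=.
  set X := cspan _; apply: (@subspace_sum _ _ X).
    by case: (cspan_closed (\bigcup_(mu in [set mu : gpath E | plen mu = 0%N])
                               range (Spath S mu))).
  move=> v _; apply: cspan_sub; exists (@GPath E (v, [::]) isT).
    by [].
  by exists x.
set X := cspan _; have cX : closed_subspace X by exact: cspan_closed.
apply: (@subspace_sum _ _ X); first by case: cX.
move=> e _; have := IH (s' e x).
apply: (cspan_maps (S_adjoint hS (inr e)) cX).
move=> _ [mu /= mud [y _ <-]].
rewrite (Spath_range hS) sPE //; case: eqP => re; last by case: cX => -[].
have we : walk (rg e) (e :: pedges mu).
  by rewrite /= eqxx re; exact: (gvalP mu).
apply: cspan_sub; exists (@GPath E (rg e, e :: pedges mu) we).
  by rewrite /= -mud.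
by exists y.
Qed.

(** [Plen d] fixes the vectors S_mu y with |mu| = d and takes values in their closed span, so that
    span is its fixed space. *)
Lemma H_C_P x : H_C S x <-> forall d, (1 <= d)%N -> Plen d x = x.
Proof.
split=> [Cx d d1|h d d1]; last by rewrite -(h d d1); exact: Plen_span.
apply: (cspan_min (closed_fixed (Plen_adjoint d)) _ (Cx d d1)).
move=> _ [mu /= <- [y _ <-]]; rewrite (Spath_range hS) Plen_SL //.
exact: (gvalP mu).
Qed.

Lemma sum_D x : \sum_(v : vert E) D v x = Psum x - Plen 1 x.
Proof.
rewrite /defect sumrB; congr (_ - _).
rewrite [RHS](eq_bigr (fun e => s e (s' e x))); last first.
  by move=> e _; rewrite /= Psum_s'.
by rewrite [RHS](partition_big (@rg E) predT).
Qed.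

(** Each edge removed by [SA] lowers the level of [Plen] by one; at level 1 only a sum of edge
    ranges is left, which [D v] kills. *)
Lemma D_SA_Plen l v x : D v (SA S l (Plen (size l).+1 x)) = 0.
Proof.
elim: l x => [|e l IH] x.
  rewrite /=; have := D_adjoint hS v => DD'.
  elim: (index_enum _) => [|e r IH]; first by rewrite big_nil (adjoint0 DD').
  by rewrite big_cons (adjointD _ _ DD') Ds // IH addr0.
rewrite -[SA _ _ _]/(SA S l (s' e (Plen (size l).+2 x))) s'_Plen P_Plen.
exact: IH.
Qed.

(** At level 0 the difference is the sum of all defects ([sum_D]); higher levels repeat this behind
    each edge. *)
Lemma Plen_stationary d x :
  (forall l v, D v (SA S l x) = 0) -> Plen d x = Plen d.+1 x.
Proof.
elim: d x => [|d IH] x h.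
  apply/eqP; rewrite -subr_eq0 -sum_D big1 // => v _; exact: (h [::] v).
apply: eq_bigr => e _; congr (s e _); apply: IH => l v.
exact: (h (e :: l)).
Qed.

(** Orthogonality to all S_mu W_v makes every level of [Plen] agree with level 0, which is the
    projection [Psum] onto the essential space. *)
Lemma H_CE : H_C S = essential S `&` oc (shift_span setT).
Proof.
apply/seteqP; split=> [x /H_C_P Cx|x []].
  split; last first.
    by apply/oc_shift_spanP => l v _; rewrite -(Cx (size l).+1) // D_SA_Plen.
  rewrite -(Cx 1%N) // essentialE /=.
  have -> : Psum (\sum_e s e (Psum (s' e x))) = \sum_e Psum (s e (Psum (s' e x))).
    rewrite /Psum exchange_big; apply: eq_bigr => v _; exact: linear_sum.
  by apply: eq_bigr => e _; rewrite Psum_s.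
rewrite essentialE => Qx /oc_shift_spanP h; apply/H_C_P => d _.
elim: d => [//|d IH]; rewrite -Plen_stationary // => l v; exact: h.
Qed.

Lemma H_C_closed : closed_subspace (H_C S).
Proof.
by rewrite H_CE; apply: closed_setI; [exact: essential_closed|exact: oc_closed].
Qed.

Lemma oc_S X : S_invariant X -> S_invariant (oc X).
Proof.
move=> SX g x ox; have SS := S_adjoint hS g.
split; first by apply: (oc_maps SS) => // y /(SX g)[].
by apply: (oc_maps (adjoint_sym SS)) => // y /(SX g)[].
Qed.

Lemma setI_S X Y : S_invariant X -> S_invariant Y -> S_invariant (X `&` Y).
Proof.
by move=> SX SY g x [/(SX g)[? ?] /(SY g)[? ?]].
Qed.

Lemma H_C_S : S_invariant (H_C S).
Proof.
rewrite H_CE; apply: setI_S; first exact: essential_S.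
by apply: oc_S; exact: shift_span_S.
Qed.

Lemma D_H_C v x : H_C S x -> D v x = 0.
Proof. by rewrite H_CE => -[_ /oc_shift_spanP/(_ [::] v)]; apply. Qed.

(** An essential vector orthogonal to every [H_ S v] lies in [H_C S]; if it is orthogonal to [H_C S]
    as well, it is 0. *)
Lemma essential_span :
  essential S = cspan (H_C S `|` \bigcup_v H_ S v).
Proof.
apply/esym/sub_closed_eq; first exact: cspan_closed.
- apply: cspan_min; first exact: essential_closed.
  move=> x [|[v _]]; first by rewrite H_CE => -[].
  by rewrite H_E; exact: shift_span_essential.
- by case: essential_closed.
move=> x ex; rewrite oc_cspan => ox.
apply: dot_eq0; apply: (ox); left; rewrite H_CE; split=> //.
apply/oc_shift_spanP => l v _; apply/dot_inj => y.
rewrite -(D_adjoint hS) -(SL_adjoint hS) dot0r; apply: dot_eq0C; apply: ox.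
by right; exists v => //; rewrite H_E; exact: shift_span_gen.
Qed.

End TCK_wold.

(** * Toeplitz representations *)

Section toeplitz_representations.
Variables (R : realType) (H : hilbert R) (E : graph) (N : self_similar E).
Variables (V : nat -> {linear H -> H}) (S : gen E -> {linear H -> H}).
Hypothesis hVS : toeplitz V S N.
Local Notation "''[' x , y ]" := (hdot H x y) : ring_scope.
Local Notation P v := (S (inl v)).
Local Notation s e := (S (inr e)).
Local Notation s' e := (adj (S (inr e))).
Local Notation D v := (defect S v).
Local Notation V' p := (adj (V p)).
Implicit Types (v w : vert E) (e f : edge E) (x y z : H) (l : seq (edge E)).
Implicit Types (Q : set (vert E)) (X : set H) (p q n m : nat).

Let hS := toeplitz_TCK hVS.

Lemma V_adjoint p : adjoint_pair (V p) (V' p).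
Proof.
apply: riesz_adjoint; exists 1 => x _.
by rewrite (toeplitz_isometry hVS) mul1r.
Qed.

Let V'V p := adjoint_sym (V_adjoint p).

Lemma V'K p x : V' p (V p x) = x.
Proof. exact: (isometry_adjointK (V_adjoint p) (toeplitz_isometry hVS p)). Qed.

Lemma VD p q x : V p (V q x) = V (p + q)%N x.
Proof. exact: (toeplitz_VD hVS). Qed.

Lemma V'D p q x : V' p (V' q x) = V' (q + p)%N x.
Proof. by apply: dot_inj => y; rewrite -!V_adjoint VD. Qed.

Lemma V0 x : V 0%N x = x.
Proof. exact: (toeplitz_V0 hVS). Qed.

Lemma V'0 x : V' 0%N x = x.
Proof. by rewrite -{1}[x]V0 V'K. Qed.

Lemma V'_small p q x : (p <= q)%N -> V' p (V q x) = V (q - p) x.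
Proof. by move=> pq; rewrite -{1}(subnKC pq) -VD V'K. Qed.

Lemma V'_large p q x : (q <= p)%N -> V' p (V q x) = V' (p - q) x.
Proof. by move=> pq; rewrite -{1}(subnKC pq) -V'D V'K. Qed.

Definition V_invariant X := forall p x, X x -> X (V p x) /\ X (V' p x).

Lemma oc_V X : V_invariant X -> V_invariant (oc X).
Proof.
move=> VX p x ox; split.
  by apply: (oc_maps (V_adjoint p)) => // y /(VX p)[].
by apply: (oc_maps (@V'V p)) => // y /(VX p)[].
Qed.

Lemma setI_V X Y : V_invariant X -> V_invariant Y -> V_invariant (X `&` Y).
Proof. by move=> VX VY p x [/(VX p)[? ?] /(VY p)[? ?]]. Qed.

Lemma H_U_P x : H_U V x <-> forall n, V n (V' n x) = x.
Proof.
split=> [Ux n|h n _]; last by exists (V' n x).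
by have [y _ <-] := Ux n I; rewrite V'K.
Qed.

Lemma H_U_V : V_invariant (H_U V).
Proof.
move=> p x Ux; split=> n _.
  have [y _ <-] := Ux n I; exists (V p y) => //.
  by rewrite !VD addnC.
have [y _ <-] := Ux (p + n)%N I; exists y => //.
by rewrite -VD V'K.
Qed.

(** Here [y] is the component of [V' n x] in ker V^*. Orthogonality makes it vanish, so V_n V_n^* x
    does not change with [n] and stays equal to [x]. That [y] lies in the kernel is proved here and
    handed to the callers. *)
Lemma H_U_intro x :
  (forall n, let y := V' n x - V 1%N (V' 1%N (V' n x)) in
     V' 1%N y = 0 -> '[V' n x, y] = 0) -> H_U V x.
Proof.
move=> xo; apply/H_U_P; elim=> [|n IH]; first by rewrite V0 V'0.
move: (xo n) => /=; set y := V' n x - _ => xy.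
have ky : V' 1%N y = 0 by rewrite /y (adjointB _ _ (@V'V 1%N)) V'K subrr.
have y0 : y = 0.
  by apply: dot_eq0; rewrite {1}/y dotBl xy // V_adjoint ky dot0r subrr.
rewrite -{2}IH -[in LHS]addn1 -VD -V'D; congr (V n _).
by apply/eqP; rewrite eq_sym -subr_eq0; apply/eqP.
Qed.

Lemma H_UE : H_U V = oc (\bigcup_(n in [set: nat]) V n @` ker_adjV V).
Proof.
apply/seteqP; split=> [x Ux _ [n _ [k /= k0 <-]]|x ox].
  have [y _ <-] := Ux n.+1 I.
  by rewrite -addn1 -VD -V'V V'K V_adjoint k0 dot0r.
apply: H_U_intro => n y ky.
by rewrite V'V; apply: ox; exists n => //; exists y.
Qed.

Lemma H_U_closed : closed_subspace (H_U V).
Proof. by rewrite H_UE; exact: oc_closed. Qed.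

Lemma H_SE : H_S V = oc (H_U V).
Proof. by rewrite H_UE -cspanE. Qed.

Lemma H_S_closed : closed_subspace (H_S V).
Proof. exact: cspan_closed. Qed.

Lemma H_S_V : V_invariant (H_S V).
Proof. by rewrite H_SE; apply: oc_V; exact: H_U_V. Qed.

Lemma H_US_orth x y : H_U V x -> H_S V y -> '[x, y] = 0.
Proof. by move=> Ux; rewrite H_SE => /(_ x Ux)/dot_eq0C. Qed.

Lemma H_US0 x : H_U V x -> H_S V x -> x = 0.
Proof. by move=> Ux Sx; apply: dot_eq0; exact: H_US_orth. Qed.

Lemma ker_H_S x : ker_adjV V x -> H_S V x.
Proof. by move=> kx; apply: cspan_sub; exists 0%N => //; exists x; rewrite ?V0. Qed.

(* If x = y + z with y in H_U, z in H_S and y = a + b along X and its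
   complement, then b lies in H_U as well and is orthogonal to x and to z. *)
Lemma H_US_split X x : closed_subspace X ->
  (forall n y, X y -> X (V n (V' n y))) -> X x ->
  exists y z, [/\ x = y + z, (X `&` H_U V) y & (X `&` H_S V) z].
Proof.
move=> cX XVV Xx; have sX := proj1 cX.
have [y Uy] := projection_theorem x H_U_closed; rewrite -H_SE => Sz.
have [a Xa ob] := projection_theorem y cX; set b := y - a in ob.
have yE : y = a + b by rewrite addrC subrK.
have Ub : H_U V b.
  apply/H_U_P => n; have /H_U_P/(_ n) := Uy.
  have VV : adjoint_pair (V n \o V' n) (V n \o V' n).
    exact: adjoint_comp (V_adjoint n) (@V'V n).
  have ob' : oc X (V n (V' n b)) by apply: (oc_maps VV) => // z /(XVV n).
  have Xa' := XVV n a Xa.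
  rewrite {1}yE -[V n _]/((V n \o V' n) _) (adjointD _ _ VV) /=.
  move=> /eqP; rewrite -subr_eq0 [X in _ - X]yE opprD addrACA addr_eq0 => /eqP h.
  (* The difference lies in [oc X], while [h] shows it to be the negative of a vector of [X]; hence
     it is orthogonal to itself. *)
  have d0 : V n (V' n b) - b = 0.
    apply: dot_eq0; rewrite {2}(_ : V n (V' n b) - b = - (V n (V' n a) - a)).
      rewrite dotNr dotBl ob' ?ob ?subrr ?oppr0 //.
        by apply: subspaceB.
      by apply: subspaceB.
    by rewrite h opprK.
  by apply/eqP; rewrite -subr_eq0 d0.
have b0 : b = 0.
  apply: dot_eq0; have := H_US_orth Ub Sz; rewrite dotBr ob // sub0r => /eqP.
  by rewrite oppr_eq0 {1}yE dotDr ob // add0r => /eqP.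
have ya : y = a by rewrite yE b0 addr0.
exists y, (x - y); split; first by rewrite addrC subrK.
  by split=> //; rewrite ya.
by split=> //; rewrite ya; apply: subspaceB.
Qed.

(** Wold decomposition inside [X]: the kernel components of [V' n x] stay in [X], so a vector
    orthogonal to the span lies in [H_U] by [H_U_intro], and also in [H_S]. *)
Lemma pure_span X : closed_subspace X -> V_invariant X -> X `<=` H_S V ->
  cspan (\bigcup_(n in [set: nat]) V n @` (ker_adjV V `&` X)) = X.
Proof.
move=> cX VX XS; apply: sub_closed_eq; first exact: cspan_closed.
- apply: cspan_min => // _ [n _ [k [_ Xk] <-]].
  by have [] := VX n k Xk.
- by case: cX.
move=> x Xx; rewrite oc_cspan => ox.
apply: H_US0 (XS x Xx); apply: H_U_intro => n y ky.
rewrite V'V; apply: ox; exists n => //; exists y => //.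
split=> //; have [_ Xn] := VX n x Xx; have [_ Xn1] := VX 1%N _ Xn.
have [Xn2 _] := VX 1%N _ Xn1.
by apply: subspaceB => //; case: cX.
Qed.

(** * Commutation relations and invariance under both families *)

Lemma VS p g x : V p (S g x) = S (act N p g) (V (res N p g) x).
Proof. exact: (toeplitz_VS hVS). Qed.

Lemma V'S p g x : V' p (S (act N p g) x) = S g (V' (res N p g) x).
Proof. exact: (toeplitz_adjVS hVS). Qed.

Lemma S'V p g x : adj (S (act N p g)) (V p x) = V (res N p g) (adj (S g) x).
Proof.
apply: dot_inj => y; rewrite -(S_adjoint hS) -V'V V'S.
by rewrite (S_adjoint hS) V'V.
Qed.

Lemma VP p v x : V p (P v x) = P (actv N p v) (V p x).
Proof. by rewrite VS res_vert. Qed.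

Lemma Vs p e x : V p (s e x) = s (acte N p e) (V (res N p (inr e)) x).
Proof. exact: (VS p (inr e)). Qed.

Lemma V's p e x : V' p (s (acte N p e) x) = s e (V' (res N p (inr e)) x).
Proof. exact: (V'S p (inr e)). Qed.

(** The action of [p] permutes the edges, taking those with range [v] onto those with range [p.v],
    so the sum in the defect is only reindexed. *)
Lemma V_D p v x : V p (D v x) = D (actv N p v) (V p x).
Proof.
rewrite /defect linearB linear_sum /= VP; congr (_ - _).
rewrite [RHS](reindex (acte N p)) /=; last first.
  exact/onW_bij/acte_bij.
apply: eq_big => [e|e _]; first by rewrite act_rg (inj_eq (@actv_inj E N p)).
by rewrite Vs -[inr (acte _ _ _)]/(act N p (inr e)) S'V.
Qed.

Lemma V'_D p v x : V' p (D (actv N p v) x) = D v (V' p x).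
Proof.
apply: dot_inj => y; rewrite -V_adjoint -!(D_adjoint hS) -V_adjoint.
by rewrite V_D.
Qed.

Lemma V_SL p l x :
  V p (SL S l x) = SL S (act_edges N p l) (V (res_edges N p l) x).
Proof. by elim: l p => [//|e l IH] p; rewrite /= Vs IH. Qed.

Lemma V'_SL p l x :
  V' p (SL S (act_edges N p l) x) = SL S l (V' (res_edges N p l) x).
Proof. by elim: l p => [//|e l IH] p; rewrite /= V's IH. Qed.

Lemma V_Spath p mu x :
  V p (Spath S mu x) = Spath S (act_path N p mu) (V (res_path N p mu) x).
Proof. by rewrite !(Spath_range hS) VP V_SL. Qed.

Lemma H_U_S : (forall e, exists m, res N m (inr e) <> 0%N) ->
  S_invariant S (H_U V).
Proof.
move=> hres; have US g x : H_U V x -> H_U V (S g x).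
  move=> /H_U_P Ux; apply/H_U_P => n.
  have [g0 <-] : exists g0, act N n g0 = g.
    case: g => [v|e]; first by have [w <-] := actv_surj N n v; exists (inl w).
    by have [f <-] := acte_surj N n e; exists (inr f).
  by rewrite V'S VS Ux.
move=> [v|e] x Ux; split; [exact: US| |exact: US|].
  by rewrite P_adj //; exact: US.
(* As [p] fixes [e], [s' e] turns [V p y] into [V (res N p (inr e)) (s' e y)], which lies in the
   range of [V m]. *)
move=> m _; have [p pe pm] := res_unbounded m (hres e).
have [y _ <-] := Ux p I.
rewrite -pe S'V -(subnKC pm) -VD.
by eexists.
Qed.

Lemma H_S_S : (forall e, exists m, res N m (inr e) <> 0%N) ->
  S_invariant S (H_S V).
Proof. by move=> hres; rewrite H_SE; apply: oc_S => //; exact: H_U_S. Qed.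

(* V p maps S_mu W_v into S_(p.mu) W_(p|_mu . v).  When mu has length at least 2,
   p|_mu . v need not be p . v, but it stays in the orbit of v. *)
Lemma shift_span_V Q : (forall p v, Q (actv N p v) <-> Q v) ->
  V_invariant (shift_span S Q).
Proof.
move=> hQ p x Qx; split; move: x Qx.
  apply: (cspan_maps (V_adjoint p) (shift_span_closed S Q)).
  move=> _ [l [v [y [Qv ->]]]]; rewrite V_SL V_D.
  by apply: shift_span_gen; apply/hQ.
apply: (cspan_maps (@V'V p) (shift_span_closed S Q)).
move=> _ [l [v [y [Qv ->]]]]; have [l' <-] := act_edges_surj N p l.
rewrite V'_SL; have [w wv] := actv_surj N (res_edges N p l') v.
rewrite -wv V'_D; apply: shift_span_gen.
by apply/(hQ (res_edges N p l')); rewrite wv.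
Qed.

(** [V' n] moves the defect vertex back along the action and [V n] returns it, so [Q] may be a
    single vertex. *)
Lemma shift_span_VV' Q n x : shift_span S Q x ->
  shift_span S Q (V n (V' n x)).
Proof.
move: x; apply: (@cspan_maps _ _ (V n \o V' n) (V n \o V' n)).
- exact: adjoint_comp (V_adjoint n) (@V'V n).
- exact: shift_span_closed.
move=> _ [l [v [y [Qv ->]]]] /=; have [l' <-] := act_edges_surj N n l.
rewrite V'_SL; have [w wv] := actv_surj N (res_edges N n l') v.
rewrite V_SL -wv V'_D V_D wv; exact: shift_span_gen.
Qed.

Lemma VPsum p x : V p (Psum S x) = Psum S (V p x).
Proof.
rewrite /Psum linear_sum [RHS](reindex (actv N p)) /=.
  by apply: eq_bigr => v _; rewrite VP.
exact/onW_bij/actv_bij.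
Qed.

Lemma essential_V : V_invariant (essential S).
Proof.
rewrite essentialE // => p x /= Qx; split; first by rewrite -VPsum Qx.
apply: dot_inj => y; rewrite -(Psum_adjoint hS) -!V_adjoint VPsum.
by rewrite (Psum_adjoint hS) Qx.
Qed.

Lemma H_C_V : V_invariant (H_C S).
Proof.
rewrite H_CE //; apply: setI_V; first exact: essential_V.
by apply: oc_V; apply: shift_span_V.
Qed.

Lemma reducing_intro X : closed_subspace X -> V_invariant X ->
  S_invariant S X -> reducing V S X.
Proof.
move=> cX VX SX; split=> // [p|g]; split=> _ [x Xx <-].
- by have [] := VX p x Xx.
- by have [] := VX p x Xx.
- by have [] := SX g x Xx.
- by have [] := SX g x Xx.
Qed.

Lemma D_H_S v x : (forall e, exists m, res N m (inr e) <> 0%N) ->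
  H_S V x -> H_S V (D v x).
Proof.
move=> hres Sx; have sS := proj1 H_S_closed; have iS := H_S_S hres.
apply: (subspaceB sS); first by have [] := iS (inl v) x Sx.
apply: (@subspace_sum _ _ (H_S V)) => // e _; have [_ Sx'] := iS (inr e) x Sx.
by have [] := iS (inr e) _ Sx'.
Qed.

Lemma D_H_U v x : (forall e, exists m, res N m (inr e) <> 0%N) ->
  H_U V x -> H_U V (D v x).
Proof.
move=> hres Ux; have sU := proj1 H_U_closed; have iU := H_U_S hres.
apply: (subspaceB sU); first by have [] := iU (inl v) x Ux.
apply: (@subspace_sum _ _ (H_U V)) => // e _; have [_ Ux'] := iU (inr e) x Ux.
by have [] := iU (inr e) _ Ux'.
Qed.

(** Membership in [HS_ V S v] is automatic: kernel vectors lie in [H_S], and fixed vectors of [D v]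
    lie in [H_ S v]. *)
Lemma WN_E v : WN_ V S v = [set x | D v x = x /\ V' 1%N x = 0].
Proof.
apply/seteqP; split=> [x [kx [y _ yx]]|x [Dx kx]].
  by split=> //; rewrite -yx DD // eqxx.
split=> //; exists x => //; split; first exact: ker_H_S.
by rewrite H_E // -Dx; exact: (@shift_span_gen _ _ _ _ _ [::]).
Qed.

Lemma WN_closed v : closed_subspace (WN_ V S v).
Proof.
rewrite WN_E; apply: (closed_setI (closed_fixed (D_adjoint hS v))).
exact: closed_kernel (@V'V 1%N).
Qed.

Lemma WN_D v w p x : WN_ V S v x -> D w (V p x) = if w == actv N p v then V p x else 0.
Proof.
by rewrite WN_E => -[Dx _]; rewrite -Dx V_D DD //; case: eqP => [->|].
Qed.

(** Cancelling the smaller power leaves a vector in the range of [V 1] against one in ker V^*. *)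
Lemma ker_V_orth p q x y : V' 1%N x = 0 -> V' 1%N y = 0 ->
  '[V p x, V q y] = if p == q then '[x, y] else 0.
Proof.
move=> kx ky; wlog pq : p q x y kx ky / (p <= q)%N.
  move=> h; have [/h->//|/ltnW qp] := leqP p q.
  by rewrite dotC h // eq_sym; case: eqP => _; rewrite -?dotC // rmorph0.
rewrite (_ : '[V p x, V q y] = '[x, V (q - p) y]); last first.
  by rewrite V_adjoint V'_small.
case: eqP => [->|/eqP pq']; first by rewrite subnn V0.
have : (0 < q - p)%N by rewrite subn_gt0 ltn_neqAle pq'.
case: (q - p)%N => // k _; rewrite -add1n -VD -V'V kx; exact: dot0l.
Qed.

Lemma WN_V_orth v w p q x y : WN_ V S v x -> WN_ V S w y ->
  '[V p x, V q y] = if p == q then '[x, y] else 0.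
Proof. by rewrite !WN_E => -[_ kx] [_ ky]; exact: ker_V_orth. Qed.

End toeplitz_representations.

(** * Components of the decomposition *)

Section wold_components.
Variables (R : realType) (H : hilbert R) (E : graph) (N : self_similar E).
Variables (V : nat -> {linear H -> H}) (S : gen E -> {linear H -> H}).
Hypothesis hVS : toeplitz V S N.
Hypothesis hres : forall e : edge E, exists m : nat, res N m (inr e) <> 0%N.
Local Notation "''[' x , y ]" := (hdot H x y) : ring_scope.
Local Notation P v := (S (inl v)).
Local Notation s e := (S (inr e)).
Local Notation s' e := (adj (S (inr e))).
Local Notation D v := (defect S v).
Local Notation V' p := (adj (V p)).
Implicit Types (v w u : vert E) (e f : edge E) (x y z : H) (l : seq (edge E)).
Implicit Types (Q : set (vert E)) (X Y : set H) (p q n m : nat).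

Let hS := toeplitz_TCK hVS.
Let V'V p := adjoint_sym (V_adjoint hVS p).
Let S'S g := adjoint_sym (S_adjoint hS g).
Let US := H_U_S hVS hres.
Let SS := H_S_S hVS hres.

Lemma Spath_orth (mu nu : gpath E) x y :
  D (psource mu) x = x -> D (psource nu) y = y ->
  '[Spath S mu x, Spath S nu y] = if mu == nu then '[x, y] else 0.
Proof.
move=> Dx Dy; case: eqP => [<-|mn].
  by rewrite Spath_isometry // -Dx PD // eqxx.
have Px : P (psource mu) x = x by rewrite -Dx PD // eqxx.
have Py : P (psource nu) y = y by rewrite -Dy PD // eqxx.
rewrite !SpathE // Px Py; have [eE|/eqP eN] := eqVneq (pedges mu) (pedges nu).
  rewrite -Dx -Dy; apply: SL_D_orth => // sE; apply: mn.
  exact: gpath_source_eq.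
exact: (SL_orth hS Dx Dy).
Qed.

Lemma gcat_source g (mu nu : gpath E) : gcat g mu = Some nu -> psource nu = psource mu.
Proof.
case: g => [v|e] /=; first by case: eqP => // _ [->].
case: eqP => // re; case: insubP => // k _ kE [<-].
by rewrite /psource /pedges /prange kE /= re.
Qed.

Lemma gcat_inj g (mu nu k : gpath E) :
  gcat g mu = Some k -> gcat g nu = Some k -> mu = nu.
Proof.
case: g => [v|e] /=; first by case: eqP => // _ [->]; case: eqP => // _ [->].
case: eqP => // rm; case: insubP => // k1 _ k1E [k1k].
case: eqP => // rn; case: insubP => // k2 _ k2E [k2k].
apply: gpath_eq; first by rewrite -rm -rn.
by have := k1E; rewrite k1k -k2k k2E => -[].
Qed.

Lemma S_Spath g (mu : gpath E) x :
  S g (Spath S mu x) = if gcat g mu is Some nu then Spath S nu x else 0.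
Proof.
rewrite (Spath_range hS); case: g => [v|e].
  by rewrite PP //=; case: eqP => // ->; rewrite (Spath_range hS).
rewrite sPE //=; case: eqP => // re; case: insubP => [k _ kE|].
  by rewrite (Spath_range hS) /prange /pedges kE /= P_rg.
by rewrite /= eqxx re (gvalP mu).
Qed.

Lemma D_WN v p x : WN_ V S v x -> D (actv N p v) (V p x) = V p x.
Proof. by move=> Wx; rewrite (WN_D hVS _ _ Wx) eqxx. Qed.

Lemma V'_WN v p q x : WN_ V S v x ->
  V' q (V p x) = if (q <= p)%N then V (p - q) x else 0.
Proof.
rewrite (WN_E hVS) => -[_ kx]; case: leqP => pq; first by rewrite (V'_small hVS).
rewrite (V'_large hVS _ (ltnW pq)).
have : (0 < q - p)%N by rewrite subn_gt0.
by case: (q - p)%N => // k _; rewrite -add1n -(V'D hVS) kx (adjoint0 (@V'V _)).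
Qed.

(** * The reducing subspaces generated by the wandering spaces *)

Lemma HSred_E v : HSred_ V S v =
  cspan [set x | exists l p (w : H), WN_ V S v w /\ x = SL S l (V p w)].
Proof.
apply/seteqP; split; apply: cspan_mono.
  move=> _ [mu _ [p _ [w Ww <-]]]; rewrite SpathE //.
  rewrite -(D_WN p Ww) PD //; case: eqP => _; last by rewrite SL0 //; exact: cspan0.
  by rewrite D_WN //; apply: cspan_sub; exists (pedges mu), p, w.
move=> _ [l [p [w [Ww ->]]]].
have [[mu _ ->]|->] := SL_W_cases hS l (D_WN p Ww); last exact: cspan0.
by apply: cspan_sub; exists mu => //; exists p => //; exists w.
Qed.

Lemma HSred_gen v l p (w : H) : WN_ V S v w -> HSred_ V S v (SL S l (V p w)).
Proof. by move=> Ww; rewrite HSred_E; apply: cspan_sub; exists l, p, w. Qed.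

Lemma HSred_closed v : closed_subspace (HSred_ V S v).
Proof. exact: cspan_closed. Qed.

Lemma HSred_ind v (T T' : H -> H) X : adjoint_pair T T' -> closed_subspace X ->
  (forall l p (w : H), WN_ V S v w -> X (T (SL S l (V p w)))) ->
  forall x, HSred_ V S v x -> X (T x).
Proof.
move=> TT' cX h; rewrite HSred_E; apply: (cspan_maps TT' cX).
by move=> _ [l [p [w [Ww ->]]]]; exact: h.
Qed.

Lemma HSred_sub v X : closed_subspace X ->
  (forall l p (w : H), WN_ V S v w -> X (SL S l (V p w))) ->
  HSred_ V S v `<=` X.
Proof. by move=> cX h x; apply: (@HSred_ind v id id). Qed.

Lemma HSred_V v : V_invariant V (HSred_ V S v).
Proof.
move=> q x Xx; split; move: x Xx.
  apply: (HSred_ind (V_adjoint hVS q) (HSred_closed v)) => l p w Ww.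
  by rewrite (V_SL hVS) (VD hVS); exact: HSred_gen.
apply: (HSred_ind (@V'V q) (HSred_closed v)) => l p w Ww.
have [l' <-] := act_edges_surj N q l.
rewrite (V'_SL hVS) (V'_WN _ _ Ww); case: leqP => _; first exact: HSred_gen.
by rewrite SL0 //; exact: cspan0.
Qed.

Lemma HSred_P v w x : HSred_ V S v x -> HSred_ V S v (P w x).
Proof.
apply: (HSred_ind (P_adjoint hS w) (HSred_closed v)) => -[|e l] p z Wz.
  rewrite -(D_WN p Wz) /= PD //; case: eqP => _; last exact: cspan0.
  by rewrite D_WN //; exact: (@HSred_gen _ [::]).
rewrite /= PsE //; case: eqP => _; last exact: cspan0.
exact: (@HSred_gen _ (e :: l)).
Qed.

Lemma HSred_S v : S_invariant S (HSred_ V S v).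
Proof.
move=> [w|e] x Xx; first by rewrite P_adj //; split; exact: HSred_P.
split; move: x Xx.
  apply: (HSred_ind (S_adjoint hS _) (HSred_closed v)) => l p w Ww.
  exact: (@HSred_gen _ (e :: l)).
apply: (HSred_ind (@S'S (inr e)) (HSred_closed v)) => -[|f l] p w Ww.
  by rewrite -(D_WN p Ww) /= s'D //; exact: cspan0.
rewrite /= s'sE //; case: eqP => _; last exact: cspan0.
by apply: HSred_P; exact: HSred_gen.
Qed.

Lemma SL_H_S l x : H_S V x -> H_S V (SL S l x).
Proof. by elim: l => [//|e l IH] /IH h; have [] := SS (inr e) h. Qed.

Lemma SA_H_S l x : H_S V x -> H_S V (SA S l x).
Proof. by elim: l x => [//|e l IH] x h; apply: IH; have [] := SS (inr e) h. Qed.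

Lemma SA_H_U l x : H_U V x -> H_U V (SA S l x).
Proof. by elim: l x => [//|e l IH] x h; apply: IH; have [] := US (inr e) h. Qed.

Lemma WN_H_S v (w : H) : WN_ V S v w -> H_S V w.
Proof. by move=> [/(ker_H_S hVS)]. Qed.

Lemma HSred_H_S v : HSred_ V S v `<=` H_S V.
Proof.
apply: HSred_sub; first exact: H_S_closed.
move=> l p w /WN_H_S Sw; apply: SL_H_S.
by have [] := H_S_V hVS p Sw.
Qed.

Lemma HSred_shift_span v : HSred_ V S v `<=` shift_span S (vorbit N v).
Proof.
apply: HSred_sub; first exact: shift_span_closed.
move=> l p w Ww; rewrite -(D_WN p Ww); apply: shift_span_gen.
by apply: vorbit_act; exact: vorbit_refl.
Qed.

(** Generators can only meet when path and exponent agree; what remains is an inner product between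
    W_v and W_w. *)
Lemma HSred_orth v w : v <> w ->
  orthogonal_sets (HSred_ V S v) (HSred_ V S w).
Proof.
move=> vw x y Xx; suff : HSred_ V S v `<=` oc (HSred_ V S w) by move=> /(_ x Xx)/[apply].
apply: HSred_sub; first exact: oc_closed.
move=> l p z Wz; rewrite HSred_E oc_cspan => _ [l' [q [t [Wt ->]]]].
have Dz := D_WN p Wz; have Dt := D_WN q Wt.
have [[mu sm ->]|->] := SL_W_cases hS l Dz; last by rewrite dot0l.
have [[nu sn ->]|->] := SL_W_cases hS l' Dt; last by rewrite dot0r.
rewrite Spath_orth ?sm ?sn // (WN_V_orth hVS _ _ Wz Wt).
suff -> : '[z, t] = 0 by rewrite !if_same.
move: Wz Wt; rewrite !(WN_E hVS) => -[<- _] [<- _].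
by rewrite (D_adjoint hS) DD //; case: eqP => // _; rewrite dot0r.
Qed.

(** * Comparison of [HS_] and [HSred_] over an orbit *)

Lemma HS_E v : HS_ V S v = H_S V `&` shift_span S [set v].
Proof. by rewrite /HS_ H_E. Qed.

Lemma HS_closed v : closed_subspace (HS_ V S v).
Proof.
by rewrite HS_E; apply: closed_setI; [exact: H_S_closed|exact: shift_span_closed].
Qed.

Lemma SL_W_HS v l y : H_S V y -> D v y = y -> HS_ V S v (SL S l y).
Proof.
move=> Sy Dy; rewrite HS_E; split; first exact: SL_H_S.
by rewrite -Dy; exact: shift_span_gen.
Qed.

Lemma shift_span_eq0 Q x : shift_span S Q x ->
  (forall l v, Q v -> D v (SA S l x) = 0) -> x = 0.
Proof. by move=> Qx /(oc_shift_spanP hS) ox; apply: dot_eq0; apply: ox. Qed.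

Lemma sum_HS Q :
  cspan (\bigcup_(u in Q) HS_ V S u) = H_S V `&` shift_span S Q.
Proof.
apply: sub_closed_eq; first exact: cspan_closed.
- apply: cspan_min.
    by apply: closed_setI; [exact: H_S_closed|exact: shift_span_closed].
  move=> x [u Qu]; rewrite HS_E => -[Sx Dx]; split=> //.
  by apply: shift_span_mono Dx => _ ->.
- exact: (proj1 (closed_setI (H_S_closed _) (shift_span_closed _ _))).
move=> x [Sx Qx]; rewrite oc_cspan => ox; apply: (shift_span_eq0 Qx) => l v Qv.
set y := D v _; have Dy : D v y = y by rewrite /y DD // eqxx.
have Sy : H_S V y by apply: (D_H_S hVS _ hres); exact: SA_H_S.
apply: dot_eq0; rewrite {1}/y (D_adjoint hS) Dy (adjoint_sym (SL_adjoint hS l)).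
by apply: ox; exists v => //; exact: SL_W_HS.
Qed.

Lemma D_ker v k : V' 1%N k = 0 -> WN_ V S v (D v k).
Proof.
move=> k0; rewrite (WN_E hVS); split; first by rewrite DD // eqxx.
have [u <-] := actv_surj N 1 v.
by rewrite (V'_D hVS) k0 (adjoint0 (D_adjoint hS u)).
Qed.

(** For [x] orthogonal to the left side, each [y = D u (SA S l x)] is orthogonal to all [V p k] with
    [k] in ker V^*, so it lies in both [H_U] and [H_S]. *)
Lemma sum_HSred v :
  cspan (\bigcup_(u in vorbit N v) HSred_ V S u)
  = H_S V `&` shift_span S (vorbit N v).
Proof.
apply: sub_closed_eq; first exact: cspan_closed.
- apply: cspan_min.
    by apply: closed_setI; [exact: H_S_closed|exact: shift_span_closed].
  move=> x [u /vorbit_eq uE Xx]; split; first exact: HSred_H_S Xx.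
  by rewrite uE; exact: HSred_shift_span.
- exact: (proj1 (closed_setI (H_S_closed _) (shift_span_closed _ _))).
move=> x [Sx Qx]; rewrite oc_cspan => ox; apply: (shift_span_eq0 Qx) => l u Qu.
set y := D u _; have Dy : D u y = y by rewrite /y DD // eqxx.
have Sy : H_S V y by apply: (D_H_S hVS _ hres); exact: SA_H_S.
apply: (H_US0 hVS) => //; rewrite (H_UE hVS) => _ [p _ [k kk <-]].
(* With [p.u0 = u], [D u] applied to [V p k] is [V p (D u0 k)], and [D u0 k] lies in the wandering
   space at [u0]. *)
have [u0 uE] := actv_surj N p u.
rewrite /y (D_adjoint hS) -uE -(V_D hVS) (adjoint_sym (SL_adjoint hS l)).
apply: ox; exists u0; first by apply: (@vorbit_inv _ N v u0 p); rewrite uE.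
by apply: HSred_gen; exact: D_ker.
Qed.

Lemma HSred_HS v : reducing V S (HS_ V S v) \/ vorbit N v = [set v] ->
  HSred_ V S v = HS_ V S v.
Proof.
have orbit1 : vorbit N v = [set v] -> HSred_ V S v = HS_ V S v.
  move=> vE; have := sum_HSred v; rewrite vE -sum_HS !bigcup_set1.
  by rewrite !cspan_id //; [exact: HS_closed|exact: HSred_closed].
move=> [red|//]; have [fix1|nfix] := pselect (actv N 1 v = v).
  apply: orbit1; apply/seteqP; split=> [_ [p _ <-]|_ ->]; last exact: vorbit_refl.
  by elim: p => [|p IH]; rewrite /= ?actv0 // -addn1 actvD fix1.
(* When [1.v] differs from [v], [V 1] sends a vector of W_v into the span at [1.v], orthogonal to
   the one at [v]; invariance then forces it to be 0. *)
have W0 y : H_S V y -> D v y = y -> y = 0.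
  move=> Sy Dy; have HSy : HS_ V S v y by exact: (@SL_W_HS v [::]).
  have [_ /(_ 1%N)[redV _] _] := red.
  have : HS_ V S v (V 1%N y) by apply: redV; exists y.
  rewrite HS_E => -[_ Vy]; rewrite -[y](V'K hVS 1%N).
  suff -> : V 1%N y = 0 by rewrite (adjoint0 (@V'V 1%N)).
  apply: dot_eq0; apply: (@shift_span_orth _ _ _ S hS [set v] [set actv N 1 v]) => //.
    by apply/seteqP; split=> // _ [-> /esym].
  rewrite -Dy (V_D hVS); exact: (@shift_span_gen _ _ _ _ _ [::]).
apply/seteqP; split.
  apply: HSred_sub; first exact: HS_closed.
  move=> l p w Ww; have -> : w = 0.
    by apply: W0; [exact: WN_H_S Ww|move: Ww; rewrite (WN_E hVS) => -[]].
  by rewrite linear0 SL0 //; have [[]] := HS_closed v.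
move=> x; rewrite HS_E => -[Sx Dx].
suff -> : x = 0 by exact: cspan0.
apply: (shift_span_eq0 Dx) => l _ ->; apply: W0; last by rewrite DD // eqxx.
by apply: (D_H_S hVS _ hres); exact: SA_H_S.
Qed.

Lemma orthogonal_setsC X Y : orthogonal_sets X Y -> orthogonal_sets Y X.
Proof. by move=> XY x y Yx Xy; apply: dot_eq0C; exact: XY. Qed.

Lemma HU_orb_E Q : HU_orb V S Q = H_U V `&` shift_span S Q.
Proof. by rewrite /HU_orb H_orbE. Qed.

(** Stated for an abstract family at the vertices, so that it applies to [HS_] and to [HSred_]. *)
Lemma orth_sum_pieces (F : vert E -> set H) :
  (forall v, closed_subspace (F v)) ->
  (forall v, F v `<=` H_S V `&` shift_span S (vorbit N v)) ->
  (forall v w, v <> w -> orthogonal_sets (F v) (F w)) ->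
  (forall v, HS_ V S v `<=` cspan (\bigcup_w F w)) ->
  orth_sum (wold_dom N) (wold_piece V S F) (essential S).
Proof.
move=> cF FS oF spanF.
have cC := H_C_closed hS; have cU := H_U_closed hVS; have cS := H_S_closed V.
have oUS X Y : X `<=` H_U V -> Y `<=` H_S V -> orthogonal_sets X Y.
  by move=> XU YS x y /XU Ux /YS Sy; exact: (H_US_orth hVS).
have oC X Y Q : X `<=` H_C S -> Y `<=` shift_span S Q -> orthogonal_sets X Y.
  move=> XC YQ x y /XC; rewrite H_CE // => -[_ ox] /YQ Qy; apply: ox.
  exact: shift_span_mono Qy.
have sI1 X Y : X `&` Y `<=` X by move=> x [].
have sI2 X Y : X `&` Y `<=` Y by move=> x [].
have FH v : F v `<=` H_S V by move=> x /FS[].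
have FQ v : F v `<=` shift_span S (vorbit N v) by move=> x /FS[].
have UH Om : HU_orb V S Om `<=` H_U V by move=> x [].
have UQ Om : HU_orb V S Om `<=` shift_span S Om by rewrite HU_orb_E => x [].
split.
- move=> [| |Om|v] _ /=; [exact: closed_setI|exact: closed_setI| |exact: cF].
  by rewrite HU_orb_E; apply: closed_setI => //; exact: shift_span_closed.
- move=> [| |Om|v] [| |Om'|w] Di Dj ij //=.
  + exact: oUS (sI1 _ _) (sI1 _ _).
  + exact: oC (sI2 _ _) (UQ Om').
  + exact: oC (sI2 _ _) (FQ w).
  + by apply: orthogonal_setsC; exact: oUS (sI1 _ _) (sI1 _ _).
  + exact: oC (sI2 _ _) (UQ Om').
  + exact: oC (sI2 _ _) (FQ w).
  + by apply: orthogonal_setsC; exact: oC (sI2 _ _) (UQ Om).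
  + by apply: orthogonal_setsC; exact: oC (sI2 _ _) (UQ Om).
  + move=> x y /UQ Qx /UQ Qy; apply: (shift_span_orth hS) Qx Qy.
    apply/seteqP; split=> // u [Omu Omu']; apply: ij; congr UnitaryShift.
    move: Di Dj Omu Omu' => [v _ <-] [v' _ <-] /vorbit_eq -> /vorbit_eq -> //.
  + exact: oUS (UH Om) (FH w).
  + by apply: orthogonal_setsC; exact: oC (sI2 _ _) (FQ v).
  + by apply: orthogonal_setsC; exact: oC (sI2 _ _) (FQ v).
  + by apply: orthogonal_setsC; exact: oUS (UH Om') (FH v).
  + by apply: oF => vw; apply: ij; rewrite vw.
set Y := cspan _; have cY : closed_subspace Y by exact: cspan_closed.
have pY i : wold_dom N i -> wold_piece V S F i `<=` Y.
  by move=> Di x ix; apply: cspan_sub; exists i.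
apply/seteqP; split.
  apply: cspan_min; first exact: essential_closed.
  move=> x [[| |Om|v] _] /=.
  - by move=> [_]; rewrite H_CE // => -[].
  - by move=> [_]; rewrite H_CE // => -[].
  - by move=> /UQ; exact: shift_span_essential.
  - by move=> /FQ; exact: shift_span_essential.
have FY v : HS_ V S v `<=` Y.
  move=> x /spanF; apply: cspan_min => // y [w _]; exact: (pY (PureShift w)).
(* It remains to split [H_C S] and each [H_ S v] along [H_U] and [H_S], both being preserved by V_n
   V_n^*. *)
rewrite essential_span //; apply: cspan_min => // x [Cx|[v _]].
  have [|y [z [-> [Cy Uy] [Cz Sz]]]] := H_US_split hVS cC _ Cx.
    move=> n y Cy; have [_ Cy'] := H_C_V hVS n Cy.
    by have [] := H_C_V hVS n Cy'.
  apply: (subspaceD (proj1 cY)); first exact: (pY UnitaryCK).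
  exact: (pY PureCK).
rewrite H_E // => vx.
have [n y|y [z [-> [vy Uy] [vz Sz]]]] := H_US_split hVS (shift_span_closed S [set v]) _ vx.
  exact: (shift_span_VV' hVS).
apply: (subspaceD (proj1 cY)).
  apply: (pY (UnitaryShift (vorbit N v))); first by exists v.
  rewrite /= HU_orb_E; split=> //; apply: shift_span_mono vy => _ ->.
  exact: vorbit_refl.
by apply: (FY v); rewrite HS_E.
Qed.

Lemma orth_sum_HS : orth_sum (wold_dom N) (wold_piece V S (HS_ V S)) (essential S).
Proof.
apply: orth_sum_pieces.
- exact: HS_closed.
- move=> v x; rewrite HS_E => -[Sx vx]; split=> //.
  by apply: shift_span_mono vx => _ ->; exact: vorbit_refl.
- move=> v w vw x y; rewrite !HS_E => -[_ vx] [_ wy].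
  by apply: (shift_span_orth hS) vx wy; apply/seteqP; split=> // u [-> ].
- by move=> v x vx; apply: cspan_sub; exists v.
Qed.

Lemma orth_sum_HSred :
  orth_sum (wold_dom N) (wold_piece V S (HSred_ V S)) (essential S).
Proof.
apply: orth_sum_pieces.
- exact: HSred_closed.
- by move=> v x vx; split; [exact: HSred_H_S vx|exact: HSred_shift_span].
- exact: HSred_orth.
- move=> v x; rewrite HS_E => -[Sx vx].
  have : (H_S V `&` shift_span S (vorbit N v)) x.
    by split=> //; apply: shift_span_mono vx => _ ->; exact: vorbit_refl.
  rewrite -sum_HSred; apply: cspan_mono => y [u _ uy].
  by apply: cspan_sub; exists u.
Qed.

Lemma vorbit_stable v p u : vorbit N v (actv N p u) <-> vorbit N v u.
Proof. by split; [exact: vorbit_inv|exact: vorbit_act]. Qed.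

Lemma reducing_pieces i : wold_dom N i -> reducing V S (wold_piece V S (HSred_ V S) i).
Proof.
have cC := H_C_closed hS; have cU := H_U_closed hVS; have cS := H_S_closed V.
case: i => [| |Om|v] /=.
- move=> _; apply: reducing_intro; first exact: closed_setI.
    by apply: setI_V; [exact: (H_U_V hVS)|exact: (H_C_V hVS)].
  by apply: setI_S => //; exact: H_C_S.
- move=> _; apply: reducing_intro; first exact: closed_setI.
    by apply: setI_V; [exact: (H_S_V hVS)|exact: (H_C_V hVS)].
  by apply: setI_S => //; exact: H_C_S.
- move=> [v _ <-]; rewrite HU_orb_E; apply: reducing_intro.
  + by apply: closed_setI => //; exact: shift_span_closed.
  + apply: setI_V; first exact: (H_U_V hVS).
    by apply: (shift_span_V hVS) => p u; exact: vorbit_stable.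
  + by apply: setI_S => //; exact: shift_span_S.
- move=> _; apply: reducing_intro; first exact: HSred_closed.
    exact: HSred_V.
  exact: HSred_S.
Qed.

(** * Identification of the restrictions to the components *)

Lemma unitary_on_H_U X : X `<=` H_U V -> V_invariant V X -> unitary_on X (V 1%N).
Proof.
move=> XU VX; split; first by move=> x _; exact: (toeplitz_isometry hVS).
apply/seteqP; split=> [_ [x Xx <-]|x Xx]; first by have [] := VX 1%N x Xx.
exists (V' 1%N x); first by have [] := VX 1%N x Xx.
by have /(H_U_P hVS) := XU x Xx; apply.
Qed.

(** On an invariant subspace the inner adjoint is the restricted one, and vanishing of the defect on
    [H_C] is the Cuntz-Krieger relation. *)
Lemma CK_on_H_C X : closed_subspace X -> S_invariant S X -> X `<=` H_C S ->
  CK_on S X.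
Proof.
move=> [sX _] SX XC.
have adjX g x : X x -> adj_on X (S g) x = adj (S g) x.
  move=> Xx; apply: (adj_on_reduced (S_adjoint hS g)) => //.
  by have [] := SX g x Xx.
have sumX v x : X x -> \sum_(e | rg e == v) s e (adj_on X (s e) x)
    = \sum_(e | rg e == v) s e (s' e x).
  by move=> Xx; apply: eq_bigr => e _; rewrite adjX.
split; last first.
  move=> v x Xx; rewrite sumX //; apply/eqP; rewrite eq_sym -subr_eq0.
  by apply/eqP; apply: D_H_C => //; exact: XC.
split.
- move=> g; split; first by move=> _ [x Xx <-]; have [] := SX g x Xx.
  by have [/(_ g)[_ [M hM]] _ _ _ _] := hS; exists M => x _; exact: hM.
- by move=> v x Xx; rewrite PP // eqxx adjX // P_adj.
- by move=> v w x vw _; rewrite PP //; case: eqP.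
- move=> e x Xx; rewrite adjX ?s'sK //.
  by have [] := SX (inr e) x Xx.
- move=> v x Xx; rewrite sumX //.
  by have [_ _ _ _ /(_ v x I)] := hS.
Qed.

Lemma pure_on_H_S X : closed_subspace X -> V_invariant V X -> X `<=` H_S V ->
  pure_on X (V 1%N).
Proof.
move=> cX VX XS; pose K := ker_adjV V `&` X.
have cK : closed_subspace K.
  by apply: closed_setI cX; exact: closed_kernel (@V'V 1%N).
have [A [b [bK b_on bspan]]] := orthonormal_basis cK.
have dT : ampl_dom (A := A) [set: nat] = setT by apply/seteqP; split.
pose c (k : nat * A) := V k.1 (b k.2).
have c_on k k' : ampl_dom setT k -> ampl_dom setT k' -> '[c k, c k'] = (k == k')%:R.
  move=> _ _; case: k k' => [n a] [n' a']; rewrite /c /= xpair_eqE.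
  rewrite (ker_V_orth hVS); [|exact: (bK a).1|exact: (bK a').1].
  by case: eqP => //= _; exact: b_on.
have c_span : cspan (c @` ampl_dom setT) = X.
  rewrite -(pure_span hVS cX VX XS); apply/seteqP; split; apply: cspan_mono.
    move=> _ [[n a] _ <-]; apply: cspan_sub; exists n => //.
    by exists (b a); first exact: bK.
  move=> _ [n _ [k Kk <-]]; move: Kk; rewrite -/K -bspan => Kk.
  apply: (cspan_maps (V_adjoint hVS n) (cspan_closed _)) Kk => _ [a _ <-].
  by apply: cspan_sub; exists (n, a).
have [U [UX UT]] := ampl_model c_on c_span.
exists A, U; split; first by move=> _ [x Xx <-]; have [] := VX 1%N x Xx.
  by rewrite -dT.
apply: (UT _ _ _ (V_adjoint hVS 1%N)).
- by move=> i j k [<-] [].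
- by [].
- by move=> i a _; rewrite /c /= (VD hVS).
Qed.

(** A basis at the single vertex [v] is carried along the orbit by V, so every [u] in the orbit has
    the same multiplicity [B]. *)
Lemma shift_model v (Om := vorbit N v) :
  exists (B : choiceType) (U : {linear H -> (gpath E * B -> R[i])}),
    unitary_onto_ell2 (HU_orb V S Om) (ampl_dom (\bigcup_(u in Om) LE_dom u)) U /\
    forall g, intertwines (HU_orb V S Om) U (S g) (ampl (LE g)).
Proof.
pose K := [set x | D v x = x] `&` H_U V.
have cK : closed_subspace K.
  by apply: (closed_setI (closed_fixed (D_adjoint hS v))); exact: (H_U_closed hVS).
have [B [b [bK b_on bspan]]] := orthonormal_basis cK.
(* [t u] moves [v] to [u]; outside the orbit the value 0 is a default. *)
have /choice[t tP] : forall u, exists p, Om u -> actv N p v = u.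
  move=> u; have [[p _ pu]|nu] := pselect (Om u); first by exists p.
  by exists 0%N.
have bU a : H_U V (b a) by have [] := bK a.
have bD a p : D (actv N p v) (V p (b a)) = V p (b a).
  by rewrite -(V_D hVS); have [/= ->] := bK a.
pose J : set (gpath E) := \bigcup_(u in Om) LE_dom u.
have JP mu : J mu <-> Om (psource mu).
  by split=> [[u Ou /= ->//]|Om_mu]; exists (psource mu).
pose c (k : gpath E * B) := Spath S k.1 (V (t (psource k.1)) (b k.2)).
have cD mu a : J mu -> D (psource mu) (V (t (psource mu)) (b a))
    = V (t (psource mu)) (b a).
  by move=> /JP /tP {1}<-.
have VV p x y : '[V p x, V p y] = '[x, y] by rewrite (V_adjoint hVS) (V'K hVS).
have c_on k k' : ampl_dom J k -> ampl_dom J k' -> '[c k, c k'] = (k == k')%:R.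
  case: k k' => [mu a] [nu a'] /= Jm Jn; rewrite /c /= Spath_orth ?cD //.
  by rewrite xpair_eqE; case: eqP => [->|//] /=; rewrite VV b_on.
have c_span : cspan (c @` ampl_dom J) = HU_orb V S Om.
  have cX : closed_subspace (H_U V `&` shift_span S Om).
    by apply: closed_setI; [exact: (H_U_closed hVS)|exact: shift_span_closed].
  rewrite HU_orb_E; apply: sub_closed_eq; first exact: cspan_closed.
  - apply: cspan_min => // _ [[mu a] /= Jm <-]; rewrite /c /= SpathE //.
    rewrite -(cD _ _ Jm) PD // eqxx; split; last first.
      by apply: shift_span_gen; apply/JP.
    rewrite cD //; elim: (pedges mu) => [|e l IH] /=; last by have [] := US (inr e) IH.
    by have [] := H_U_V hVS (t (psource mu)) (bU a).
  - exact: proj1 cX.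
  move=> x [Ux Ox]; rewrite oc_cspan => ox; apply: (shift_span_eq0 Ox) => l u Ou.
  set y := D u _; have Dy : D u y = y by rewrite /y DD // eqxx.
  have Uy : H_U V y by apply: (D_H_U hVS _ hres); exact: SA_H_U.
  (* On [H_U] the vector [y] is recovered from [V' (t u) y], which lies in [K] and is shown
     orthogonal to its basis. *)
  have /(H_U_P hVS)/(_ (t u)) <- := Uy.
  suff -> : V' (t u) y = 0 by rewrite linear0.
  have Ky : K (V' (t u) y).
    split; last by have [] := H_U_V hVS (t u) Uy.
    by rewrite /= -(V'_D hVS) tP // Dy.
  apply: dot_eq0; move: (Ky); rewrite -bspan cspanE; apply=> _ [a _ <-].
  rewrite V'V /y (D_adjoint hS) -{1}(tP u Ou) bD.
  rewrite (adjoint_sym (SL_adjoint hS l)); have Db := bD a (t u).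
  rewrite tP // in Db.
  have [[mu sm ->]|->] := SL_W_cases hS l Db; last exact: dot0r.
  by apply: ox; exists (mu, a); rewrite /c /= ?sm //; apply/JP; rewrite sm.
have [U [UX UT]] := ampl_model c_on c_span.
exists B, U; split=> // g; apply: (UT _ _ _ (S_adjoint hS g)).
- exact: gcat_inj.
- by move=> mu nu /gcat_source e; rewrite -!/(J _) !JP e.
- move=> mu a Jm; rewrite /c /= S_Spath.
  by case gm : (gcat g mu) => [nu|//]; rewrite (gcat_source gm).
Qed.

(** [V p (b a)] sits at the vertex [p.v], so S_mu does not kill it exactly when [psource mu] is
    [p.v]; this is the index set [lam_dom]. *)
Lemma left_regular_model v :
  exists (A : choiceType) (U : {linear H -> ((gpath E * nat) * A -> R[i])}),
    [/\ hilbert_dim (WN_ V S v) A,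
        unitary_onto_ell2 (HSred_ V S v) (ampl_dom (lam_dom N v)) U,
        forall p, intertwines (HSred_ V S v) U (V p) (ampl (lamN N p))
      & forall g, intertwines (HSred_ V S v) U (S g) (ampl (lamE g))].
Proof.
have [A hA] := orthonormal_basis (WN_closed hVS v).
have [b [bW b_on bspan]] := hA.
pose c (k : gpath E * nat * A) := Spath S k.1.1 (V k.1.2 (b k.2)).
have cD mu p a : lam_dom N v (mu, p) -> D (psource mu) (V p (b a)) = V p (b a).
  by rewrite /lam_dom /= => ->; exact: D_WN.
have c_on k k' : ampl_dom (lam_dom N v) k -> ampl_dom (lam_dom N v) k' ->
    '[c k, c k'] = (k == k')%:R.
  case: k k' => [[mu p] a] [[nu q] a'] /= Jm Jn; rewrite /c /= Spath_orth ?cD //.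
  rewrite !xpair_eqE (WN_V_orth hVS _ _ (bW a) (bW a')) b_on.
  by do 2 (case: eqP => _ //=).
have c_span : cspan (c @` ampl_dom (lam_dom N v)) = HSred_ V S v.
  apply/seteqP; split; apply: cspan_mono.
    move=> _ [[[mu p] a] _ <-]; apply: cspan_sub; exists mu => //.
    by exists p => //; exists (b a); first exact: bW.
  move=> _ [mu _ [p _ [w Ww <-]]].
  have [sm|nsm] := pselect (psource mu = actv N p v); last first.
    rewrite SpathE // -(D_WN p Ww) PD //; case: eqP => // _.
    by rewrite SL0 //; exact: cspan0.
  move: Ww; rewrite -bspan.
  have TT' : adjoint_pair (fun x => Spath S mu (V p x))
      (fun x => V' p (SA S (pedges mu) (P (prange mu) x))).
    move=> x y; rewrite (Spath_range hS) (P_adjoint hS) (SL_adjoint hS).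
    exact: (V_adjoint hVS).
  apply: (cspan_maps TT' (cspan_closed _)) => _ [a _ <-].
  by apply: cspan_sub; exists (mu, p, a).
have [U [UX UT]] := ampl_model c_on c_span.
exists A, U; split=> // [q|g].
- apply: (UT _ _ _ (V_adjoint hVS q)).
  (* Equal image paths force equal paths, hence equal restrictions, which cancel in the second
     coordinate. *)
  + move=> [mu p] [nu p'] k /Some_inj <- /Some_inj /eqP.
    rewrite xpair_eqE /= => /andP[/eqP/(@act_path_inj E N q) ->].
    by rewrite eqn_add2l => /eqP ->.
  + move=> [mu p] _ /Some_inj <-; rewrite /lam_dom /= psource_act actvD.
    by split=> [->//|/actv_inj].
  + by move=> [mu p] a _; rewrite /c /= (V_Spath hVS) (VD hVS).
- apply: (UT _ _ _ (S_adjoint hS g)).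
  + move=> [mu p] [nu p'] k /=.
    case gm : (gcat g mu) => [mu'|//] [<-].
    by case gn : (gcat g nu) => [nu'|//] [n' ->]; rewrite -n' in gm; rewrite (gcat_inj gm gn).
  + move=> [mu p] [nu p'] /=; case gm : (gcat g mu) => [mu'|//] [<- <-].
    by rewrite /lam_dom /= (gcat_source gm).
  + move=> [mu p] a _; rewrite /c /= S_Spath.
    by case: (gcat g mu).
Qed.

(** The vectors with [psource mu] different from [p.v] vanish; the others are orthonormal by
    [Spath_orth] and [WN_V_orth]. *)
Lemma WN_wandering v xi : WN_ V S v xi -> `|xi| = 1 -> wandering_vector V S xi.
Proof.
move=> Wx x1; have x1' : '[xi, xi] = 1 by rewrite hdotE x1 expr1n.
have Sp mu p : psource mu <> actv N p v -> Spath S mu (V p xi) = 0.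
  move=> sm; rewrite SpathE // -(D_WN p Wx) PD //; case: eqP => // _.
  exact: SL0.
have Dm mu p : psource mu = actv N p v -> D (psource mu) (V p xi) = V p xi.
  by move=> ->; exact: D_WN.
split=> // [mu p nu q pq|mu p].
  have [/Dm sm|/Sp ->] := pselect (psource mu = actv N p v); last exact: dot0l.
  have [/Dm sn|/Sp ->] := pselect (psource nu = actv N q v); last exact: dot0r.
  rewrite Spath_orth // (WN_V_orth hVS _ _ Wx Wx).
  by case: eqP => // mn; case: eqP => // pq'; case: pq; rewrite mn pq'.
have [/Dm sm|/Sp ->] := pselect (psource mu = actv N p v); [right|by left].
apply/eqP; rewrite -(@eqrXn2 _ 2) // expr1n -hdotE Spath_orth // eqxx.
by rewrite (WN_V_orth hVS _ _ Wx Wx) eqxx x1'.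
Qed.

End wold_components.

(** * The decomposition assembled from its components *)

Theorem theorem3p7 (R : realType) (H : hilbert R) (E : graph)
  (N : self_similar E)
  (hres : forall e : edge E, exists m : nat, res N m (inr e) <> 0%N)
  (V : nat -> {linear H -> H}) (S : gen E -> {linear H -> H})
  (hVS : toeplitz V S N) :
  (* orthogonal decomposition *)
  (nondegenerate_family S ->
     orth_sum (wold_dom N) (wold_piece V S (HS_ V S)) setT /\
     orth_sum (wold_dom N) (wold_piece V S (HSred_ V S)) setT) /\
  orth_sum (wold_dom N) (wold_piece V S (HS_ V S)) (essential S) /\
  orth_sum (wold_dom N) (wold_piece V S (HSred_ V S)) (essential S) /\
  (* into reducing subspaces *)
  (forall i, wold_dom N i -> reducing V S (wold_piece V S (HSred_ V S) i)) /\
  (* comparison of the two families attached to the vertices *)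
  (forall v, reducing V S (HS_ V S v) \/ vorbit N v = [set v] ->
     HSred_ V S v = HS_ V S v) /\
  (forall v, cspan (\bigcup_(u in vorbit N v) HSred_ V S u) =
             cspan (\bigcup_(u in vorbit N v) HS_ V S u)) /\
  (* (i) *)
  (unitary_on (H_CU V S) (V 1%N) /\ CK_on S (H_CU V S)) /\
  (* (ii) *)
  (pure_on (H_CS V S) (V 1%N) /\ CK_on S (H_CS V S)) /\
  (* (iii) *)
  (forall v,
     unitary_on (HU_orb V S (vorbit N v)) (V 1%N) /\
     exists (B : choiceType) (U : {linear H -> (gpath E * B -> R[i])}),
       unitary_onto_ell2 (HU_orb V S (vorbit N v))
         (ampl_dom (\bigcup_(u in vorbit N v) LE_dom u)) U /\
       forall g, intertwines (HU_orb V S (vorbit N v)) U (S g)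
                   (ampl (LE g))) /\
  (* (iv) *)
  (forall v,
     (exists (A : choiceType)
             (U : {linear H -> ((gpath E * nat) * A -> R[i])}),
        [/\ hilbert_dim (WN_ V S v) A,
            unitary_onto_ell2 (HSred_ V S v) (ampl_dom (lam_dom N v)) U,
            forall p, intertwines (HSred_ V S v) U (V p) (ampl (lamN N p))
          & forall g, intertwines (HSred_ V S v) U (S g) (ampl (lamE g))]) /\
     forall xi, WN_ V S v xi -> `|xi| = 1 -> wandering_vector V S xi).
Proof.
have hS := toeplitz_TCK hVS.
have C0 := H_C_closed hS; have U0 := H_U_closed hVS; have S0 := H_S_closed V.
have cCU : closed_subspace (H_CU V S) by exact: closed_setI.
have cCS : closed_subspace (H_CS V S) by exact: closed_setI.
have vCU : V_invariant V (H_CU V S).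
  by apply: setI_V; [exact: (H_U_V hVS)|exact: (H_C_V hVS)].
have vCS : V_invariant V (H_CS V S).
  by apply: setI_V; [exact: (H_S_V hVS)|exact: (H_C_V hVS)].
have sCU : S_invariant S (H_CU V S).
  by apply: setI_S; [exact: (H_U_S hVS)|exact: H_C_S].
have sCS : S_invariant S (H_CS V S).
  by apply: setI_S; [exact: (H_S_S hVS)|exact: H_C_S].
have sumHS := orth_sum_HS hVS; have sumHSred := orth_sum_HSred hVS hres.
split.
  move=> nd; have essT : essential S = setT.
    by apply/seteqP; split=> // x _; exists x.
  by rewrite -essT.
split=> //; split=> //.
split; first exact: reducing_pieces.
split; first exact: HSred_HS.
split; first by move=> v; rewrite (sum_HS hVS hres) (sum_HSred hVS hres).
split.
  split; first by apply: (unitary_on_H_U hVS) => // x [].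
  by apply: (CK_on_H_C hVS) => // x [].
split.
  split; first by apply: (pure_on_H_S hVS) => // x [].
  by apply: (CK_on_H_C hVS) => // x [].
split.
  move=> v; split; last exact: shift_model.
  apply: (unitary_on_H_U hVS); first by move=> x [].
  rewrite (HU_orb_E hVS); apply: setI_V; first exact: (H_U_V hVS).
  by apply: (shift_span_V hVS) => p u; exact: vorbit_stable.
move=> v; split; first exact: left_regular_model.
exact: (WN_wandering hVS).
Qed.
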